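(* Let $h:\mathbb{C}^2\to\mathbb{C}^2$, $h(x,y)=(x-y^2+ax^3,\,y-xy)$. If $a\in\mathbb{R}_{>0}$, then $h$ has no domain of attraction to the origin along any direction; that is, for every $[v]\in\mathbb{P}^1(\mathbb{C})$ there is no domain of attraction of $h$ to the origin along $[v]$.
   Context: For a holomorphic self-map $F$ of $\mathbb{C}^2$ fixing the origin $O$ and tangent to the identity there ($\mathrm{d}F(O)=\mathrm{Id}$, $F\not\equiv\mathrm{Id}$), and $[v]\in\mathbb{P}^1(\mathbb{C})$, a domain of attraction to the origin along $[v]$ is a (non-empty, open, connected) domain $\Omega\subset\mathbb{C}^2$ with the origin in its boundary such that $F(\Omega)\subset\Omega$ and, for every $z\in\Omega$, $F^n(z)\to O$ and $[F^n(z)]\to[v]$ in $\mathbb{P}^1(\mathbb{C})$ as $n\to\infty$, where $F^n$ denotes the $n$-th iterate. *)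

(* Defs.v *)
From HB Require Import structures.
From mathcomp Require Import all_boot all_order all_algebra.
From mathcomp Require Import complex.
From mathcomp Require Import all_classical all_reals all_analysis.

Set Implicit Arguments.
Unset Strict Implicit.
Unset Printing Implicit Defensive.

Import Order.TTheory GRing.Theory Num.Theory.
Import numFieldNormedType.Exports.

Local Open Scope classical_set_scope.
Local Open Scope ring_scope.

(* R[i] is bundled as a numClosedFieldType because the norm topology is
   attached to the carriers of abstract numFieldTypes, not to [complex]. *)
Definition C (R : realType) : numClosedFieldType := R[i].

Definition C2 (R : realType) : normedModType (C R) := (C R * C R)%type.

Definition embed (R : realType) (a : R) : C R := (a%:C)%C.

Section ProjectiveLine.
Variable R : realType.

Definition C2nz : topologicalType := set_type [set p : C2 R | p != 0].

Definition collinear (p q : C2nz) : bool :=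
  `[< exists c : C R, c != 0 /\ \val q = c *: \val p >].

Lemma collinear_refl : reflexive collinear.
Proof. by move=> p; apply/asboolP; exists 1; rewrite oner_neq0 scale1r. Qed.

Lemma collinear_sym : symmetric collinear.
Proof.
suff H p q : collinear p q -> collinear q p.
  by move=> p q; apply/idP/idP; apply: H.
move=> /asboolP[c [c0 e]]; apply/asboolP; exists c^-1.
by rewrite invr_eq0 e scalerA mulVf // scale1r.
Qed.

Lemma collinear_trans : transitive collinear.
Proof.
move=> q p r /asboolP[c [c0 e]] /asboolP[d [d0 f]].
by apply/asboolP; exists (d * c); rewrite mulf_neq0 // f e scalerA.
Qed.

Canonical collinear_equiv :=
  EquivRel collinear collinear_refl collinear_sym collinear_trans.

Definition P1 : topologicalType :=
  quotient_topology {eq_quot collinear_equiv}%qT.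

Definition P1_class (p : C2nz) : P1 := (\pi_{eq_quot collinear_equiv} p)%qT.

End ProjectiveLine.

(* The sequence u is (F^n(z)) with its values seen as nonzero vectors, so that
   [F^n(z)] is defined.  The orbit does avoid 0: it stays in Omega, and an open
   set does not contain its boundary point 0. *)
Definition domain_of_attraction (R : realType) (F : C2 R -> C2 R) (v : P1 R)
    (Omega : set (C2 R)) : Prop :=
  [/\ [/\ Omega !=set0, open Omega & connected Omega],
      (closure Omega `\` interior Omega) 0,
      F @` Omega `<=` Omega
    & forall z, Omega z ->
        iter n F z @[n --> \oo] --> (0 : C2 R) /\
        exists u : nat -> C2nz R,
          (forall n, \val (u n) = iter n F z) /\
          P1_class (u n) @[n --> \oo] --> v].

Definition h (R : realType) (a : R) (p : C2 R) : C2 R :=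
  let: (x, y) := p in (x - y ^+ 2 + embed a * x ^+ 3, y - x * y).

(* Main.v *)
(** Let (x_n, y_n) be an orbit tending to O with [x_n : y_n] -> [v].

    Suppose [v] = [w0 : 1], and put w = x / y, Y = 1 / y. Then
    Y_(n+1) - Y_n -> w0, and Z = (w - w0) Y has Z_(n+1) - Z_n -> w0^2 - 1 while
    Z_n = o(n), whence w0^2 = 1. Replacing y by w0 y we may take w0 = 1, and
    then x_n ~ y_n ~ 1/n. In a thin sector around this direction h expands
    x - y, and preserves the cone |d(x + y)| <= |d(x - y)|; so two orbits that
    stay in the sector and start in this relative position coincide. By Baire,
    some h^N maps an open set V to points whose orbits stay in the sector; at a
    point of V whose orbit avoids the zeros of the Jacobian of h, a suitable
    line through the point yields two distinct such orbits.

    Suppose [v] = [1 : 0]. The quadratic part of h - id is a vector field with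
    first integral sigma^2 = x^2 - y^2, and its flow multiplies
    W = y / (x + sigma) by exp (- sigma t). For h itself, with k = x / sigma -> 1
    and a suitable polynomial G with G 1 = 0, the quantity J = 1 / sigma + G k
    becomes J - a sigma + o(sigma^2), and W becomes
    W (1 - sigma - a sigma^2 + o(sigma^2)). Hence J_n^2 ~ - 2 a n, so sigma_n
    is almost purely imaginary: then Re J_n is bounded below, because
    Re J increases as soon as it is <= - 2, and a ln |W_n| - Re J_n eventually
    increases, because - Re (sigma^2) ~ |sigma|^2 > 0. So W_n does not tend
    to 0, unless W_n = 0 for some n; but this happens only if y_m = 0 or x_m = 1
    for some m, which a generic point avoids. *)

From HB Require Import structures.
Require Import Defs.
From mathcomp Require Import all_boot all_order all_algebra.
From mathcomp Require Import complex.
From mathcomp Require Import all_classical all_reals all_analysis.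
From mathcomp Require Import ring lra.

Set Implicit Arguments.
Unset Strict Implicit.
Unset Printing Implicit Defensive.

Import Order.TTheory GRing.Theory Num.Theory.
Import numFieldNormedType.Exports.

Local Open Scope classical_set_scope.
Local Open Scope ring_scope.

(** * Real-valued norm and limits of complex sequences *)

Section ComplexNorm.
Variable R : realType.
Implicit Types (z w : C R) (u v : nat -> C R).

Definition cre z : R := complex.Re z.
Definition cim z : R := complex.Im z.
(** The norm of [C R] takes its values in [C R]; its real part is used instead, so that estimates
    live in the ordered field [R], within reach of [lra] and [nra]. *)
Definition nrm z : R := complex.Re `|z|.

Lemma embedB (x y : R) : embed (x - y) = embed x - embed y.
Proof. exact: rmorphB. Qed.

Lemma embedM (x y : R) : embed (x * y) = embed x * embed y.
Proof. exact: rmorphM. Qed.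

Lemma embedV (x : R) : embed x^-1 = (embed x)^-1.
Proof. exact: fmorphV. Qed.

Lemma embed_nat n : embed (n%:R : R) = n%:R.
Proof. exact: rmorph_nat. Qed.

Lemma nrmE z : `|z| = embed (nrm z).
Proof. by rewrite /nrm /embed RRe_real // normr_real. Qed.

Lemma nrm_ge0 z : 0 <= nrm z.
Proof. by have := normr_ge0 z; rewrite nrmE ler0c. Qed.

Lemma nrmM z w : nrm (z * w) = nrm z * nrm w.
Proof. by apply: complexI; rewrite rmorphM /= -!/(embed _) -!nrmE normrM. Qed.

Lemma nrmX z n : nrm (z ^+ n) = nrm z ^+ n.
Proof. by apply: complexI; rewrite rmorphXn /= -!/(embed _) -!nrmE normrX. Qed.

Lemma nrmV z : nrm z^-1 = (nrm z)^-1.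
Proof. by apply: complexI; rewrite fmorphV /= -!/(embed _) -!nrmE normfV. Qed.

Lemma nrmN z : nrm (- z) = nrm z.
Proof. by rewrite /nrm normrN. Qed.

Lemma nrmD z w : nrm (z + w) <= nrm z + nrm w.
Proof.
by have := ler_normD z w; rewrite !nrmE /embed -rmorphD /= lecR.
Qed.

Lemma nrmB z w : nrm (z - w) <= nrm z + nrm w.
Proof. by rewrite -(nrmN w) nrmD. Qed.

Lemma nrm_embed_norm (x : R) : nrm (embed x) = `|x|.
Proof. by rewrite /embed /nrm normc_def /= expr0n /= addr0 sqrtr_sqr. Qed.

Lemma nrm_embed (x : R) : 0 <= x -> nrm (embed x) = x.
Proof. by move=> x0; rewrite nrm_embed_norm ger0_norm. Qed.

Lemma nrm1 : nrm 1 = 1.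
Proof. by rewrite /nrm normr1. Qed.

Lemma nrm_nat n : nrm n%:R = n%:R.
Proof.
by apply: complexI; rewrite rmorph_nat -/(embed _) -nrmE normr_nat.
Qed.

Lemma nrm0 : nrm 0 = 0.
Proof. by rewrite /nrm normr0. Qed.

Lemma nrm_gt0 z : (0 < nrm z) = (z != 0).
Proof. by rewrite -normr_gt0 nrmE ltcR. Qed.

Lemma creD z w : cre (z + w) = cre z + cre w.
Proof. by case: z w => [a b] [c d]. Qed.

Lemma creN z : cre (- z) = - cre z.
Proof. by case: z. Qed.

Lemma creB z w : cre (z - w) = cre z - cre w.
Proof. by rewrite creD creN. Qed.

Lemma creM_embed (x : R) z : cre (embed x * z) = x * cre z.
Proof. by case: z => [a b]; rewrite /cre /= mul0r subr0. Qed.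

Lemma sqr_nrm z : nrm z ^+ 2 = cre z ^+ 2 + cim z ^+ 2.
Proof. by apply: complexI; rewrite add_Re2_Im2 rmorphXn /= -/(embed _) -nrmE. Qed.

Lemma cre_sqr z : cre (z ^+ 2) = cre z ^+ 2 - cim z ^+ 2.
Proof. by case: z => [a b]; rewrite /cre /cim expr2 /= -!expr2. Qed.

Lemma cre_inv z : cre z^-1 = cre z / nrm z ^+ 2.
Proof. by rewrite sqr_nrm; case: z. Qed.

Lemma cre_cim z : z = embed (cre z) + 'i%C * embed (cim z).
Proof. exact: complexE. Qed.

Lemma cre_nrm z : `|cre z| <= nrm z.
Proof.
by rewrite -(@ler_pXn2r _ 2) ?nnegrE ?nrm_ge0 // real_normK ?num_real //
  sqr_nrm lerDl sqr_ge0.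
Qed.

Lemma nrm_i : nrm 'i%C = 1.
Proof.
apply/eqP; rewrite -(@eqrXn2 _ 2) ?nrm_ge0 // sqr_nrm.
by rewrite /cre /cim /= expr0n /= add0r.
Qed.

Lemma cim_nrm z : `|cim z| <= nrm z.
Proof.
by rewrite -(@ler_pXn2r _ 2) ?nnegrE ?nrm_ge0 // real_normK ?num_real //
  sqr_nrm lerDr sqr_ge0.
Qed.

Lemma nrm_le_re_im z : nrm z <= `|cre z| + `|cim z|.
Proof.
rewrite -(@ler_pXn2r _ 2) ?nnegrE ?nrm_ge0 ?addr_ge0 // sqr_nrm sqrrD.
by rewrite !real_normK ?num_real // lerD2r lerDl mulrn_wge0 ?mulr_ge0.
Qed.

Lemma embed_gt0 (x : R) : (0 < embed x) = (0 < x).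
Proof. by rewrite ltcR. Qed.

Lemma cvg_near_nrm (T : Type) (F : set_system T) {FF : Filter F} (f : T -> C R)
    (l : C R) (e : R) : 0 < e -> f x @[x --> F] --> l ->
  \forall x \near F, nrm (f x - l) < e.
Proof.
move=> e0 /cvgrPdist_lt /(_ (embed e)); rewrite embed_gt0 => /(_ e0).
by apply: filterS => x; rewrite nrmE ltcR -nrmN opprB.
Qed.

Lemma cvg_near_neq0 u (l : C R) : u @ \oo --> l -> l != 0 ->
  \forall n \near \oo, u n != 0.
Proof.
rewrite -nrm_gt0 => ul l0; apply: filterS (cvg_near_nrm l0 ul) => n.
by apply: contraTneq => ->; rewrite sub0r nrmN ltxx.
Qed.

Lemma near_nrm_cvg (T : Type) (F : set_system T) {FF : Filter F} (f : T -> C R)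
    (l : C R) :
  (forall e : R, 0 < e -> \forall x \near F, nrm (f x - l) < e) ->
  f x @[x --> F] --> l.
Proof.
move=> H; apply/cvgrPdist_lt => e e0.
have eE : e = embed (cre e) by rewrite /embed /cre RRe_real // gtr0_real.
move: e0; rewrite eE embed_gt0 => /H; apply: filterS => x.
by rewrite nrmE ltcR -nrmN opprB.
Qed.

Lemma continuous_embed : continuous (@embed R).
Proof.
move=> x; apply: near_nrm_cvg => e e0; near=> t.
have -> : embed t - embed x = embed (t - x) :> C R by rewrite embedB.
rewrite nrm_embed_norm distrC; near: t.
have /cvgrPdist_lt : y @[y --> x] --> x by exact: cvg_id.
exact.
Unshelve. all: by end_near. Qed.

(** By telescoping, $|u_n-u_0-nl|$ is at most the sum of the $|u_{k+1}-u_k-l|$, whose means tend to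
    0 by the real Cesàro theorem. *)
Lemma cesaro_complex u (l : C R) : (u n.+1 - u n) @[n --> \oo] --> l ->
  (u n.+1 / n.+1%:R) @[n --> \oo] --> l.
Proof.
move=> du.
pose d n : R := nrm (u n.+1 - u n - l).
have d0 : d @ \oo --> (0 : R).
  apply/cvgrPdist_lt => e e0.
  apply: filterS (cvg_near_nrm e0 du) => n.
  by rewrite sub0r normrN ger0_norm ?nrm_ge0.
have S n : nrm (u n - u 0%N - n%:R * l) <= series d n.
  elim: n => [|n IH]; first by rewrite subrr mul0r subr0 nrm0 /series /= big_nil.
  rewrite /series /= big_nat_recr //=.
  apply: le_trans (lerD IH (lexx _)); apply: le_trans (nrmD _ _).
  by rewrite le_eqVlt; apply/orP; left; apply/eqP; congr nrm; rewrite -natr1; ring.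
have nC n : embed n.+1%:R = n.+1%:R :> C R by rewrite /embed rmorph_nat.
have nN n : nrm (n.+1%:R) = n.+1%:R :> R by rewrite -nC nrm_embed.
apply: near_nrm_cvg => e e0.
have e2 : 0 < e / 2 by rewrite divr_gt0.
have /cvgrPdist_lt /(_ _ e2) A := cesaro d0.
have B : \forall n \near \oo, nrm (u 0%N) / (e / 2) < n%:R by exact: nbhs_infty_gtr.
near=> n.
have n0 : (n.+1%:R : R) != 0 by rewrite pnatr_eq0.
have -> : u n.+1 / n.+1%:R - l
   = n.+1%:R^-1 * (u n.+1 - u 0%N - n.+1%:R * l) + n.+1%:R^-1 * u 0%N.
  by field; rewrite addrC natr1 pnatr_eq0.
rewrite (le_lt_trans (nrmD _ _)) // !nrmM nrmV nN (splitr e) ltrD //.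
  have An : `|0 - arithmetic_mean d n| < e / 2 by near: n.
  apply: le_lt_trans An; rewrite sub0r normrN.
  by rewrite (le_trans _ (ler_norm _)) // /arithmetic_mean ler_wpM2l ?S // invr_ge0.
rewrite ltr_pdivrMl // -ltr_pdivrMr //.
have Bn : nrm (u 0%N) / (e / 2) < n%:R by near: n.
by apply: lt_le_trans Bn _; rewrite ler_nat.
Unshelve. all: by end_near. Qed.

End ComplexNorm.

(** * Expansion along the transversal directions *)

Section Cone.
Variable R : realType.
Implicit Types (x y : C R).

(** A thin neighbourhood of the half-line $x=y>0$ near the origin. For $d>0$ the second condition
    forces $\mathrm{Re}\,x\ge0$. Non-strict inequalities make the set closed, as the use of Baire's
    theorem requires. *)
Definition sector (d : R) x y :=
  [/\ nrm (x - y) <= d * cre x, `|cim x| <= d * cre x & cre x <= d].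

(** Between two points, the quadratic part of [h] varies exactly as its derivative at the midpoint
    $(X,Y)$ does. At a real midpoint $(r,r)$ the quadratic map sends $e$ to $(1+r)e$ and $p$ to
    $(1-2r)p+re$; in the sector all deviations are $O(dr)|e|$, too small to undo this. *)
Lemma cone_step (a d : R) x y x' y' : 0 < a -> 0 < d -> 12 * (1 + a) * d <= 1 / 4 ->
  sector d x y -> sector d x' y' ->
  let x1 := x - y ^+ 2 + embed a * x ^+ 3 in let y1 := y - x * y in
  let x1' := x' - y' ^+ 2 + embed a * x' ^+ 3 in let y1' := y' - x' * y' in
  nrm ((x + y) - (x' + y')) <= nrm ((x - y) - (x' - y')) ->
  nrm ((x1 + y1) - (x1' + y1')) <= nrm ((x1 - y1) - (x1' - y1')) /\
  nrm ((x - y) - (x' - y')) <= nrm ((x1 - y1) - (x1' - y1')).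
Proof.
move=> a0 d0 da [h1 h2 h3] [h1' h2' h3'] /=.
set p := (x + y) - (x' + y'); set e := (x - y) - (x' - y') => pe.
pose r := (cre x + cre x') / 2.
have cx0 : 0 <= cre x.
  by rewrite -(pmulr_rge0 _ d0) (le_trans (normr_ge0 _) h2).
have cx0' : 0 <= cre x'.
  by rewrite -(pmulr_rge0 _ d0) (le_trans (normr_ge0 _) h2').
have r0 : 0 <= r by rewrite /r; lra.
have rd : r <= d by rewrite /r; lra.
have d1 : d <= 1 / 48 by nra.
have nx : nrm x <= 2 * cre x.
  by apply: le_trans (nrm_le_re_im _) _; rewrite ger0_norm //; nra.
have nx' : nrm x' <= 2 * cre x'.
  by apply: le_trans (nrm_le_re_im _) _; rewrite ger0_norm //; nra.
(* The divided difference of the cubic term: $ax^3-ax'^3=S(x-x')$. *)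
pose S := embed a * (x ^+ 2 + x * x' + x' ^+ 2).
have nS : nrm S <= 16 * a * d * r.
  rewrite /S nrmM nrm_embed; last exact: ltW.
  have n1 := nrm_ge0 x; have n2 := nrm_ge0 x'.
  have : nrm (x ^+ 2 + x * x' + x' ^+ 2) <= 16 * d * r.
    apply: le_trans (nrmD _ _) _; apply: le_trans (lerD (nrmD _ _) (lexx _)) _.
    rewrite nrmM !nrmX.
    have : (nrm x + nrm x') ^+ 2 <= (4 * r) ^+ 2.
      by rewrite ler_pXn2r // ?nnegrE; rewrite /r; lra.
    have : r * r <= d * r by rewrite ler_wpM2r.
    have : 0 <= nrm x * nrm x' by rewrite mulr_ge0.
    by rewrite !expr2; lra.
  move=> H; have -> : 16 * a * d * r = a * (16 * d * r) by ring.
  by rewrite ler_wpM2l //; exact: ltW.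
pose X := (x + x') / 2; pose Y := (y + y') / 2.
have two0 : (2 : C R) != 0 by rewrite pnatr_eq0.
have n2V z : nrm (z / 2) = nrm z / 2 by rewrite nrmM nrmV nrm_nat.
have XE : X - embed r = ('i%C * embed (cim x) + 'i%C * embed (cim x')) / 2.
  have -> : embed r = (embed (cre x) + embed (cre x')) / 2.
    by rewrite /embed /r rmorphM fmorphV rmorphD rmorph_nat.
  rewrite /X {1}(cre_cim x) {1}(cre_cim x'); ring.
have nX : nrm (X - embed r) <= d * r.
  rewrite XE n2V ler_pdivrMr // (le_trans (nrmD _ _)) // !nrmM !nrm_i !mul1r.
  by rewrite !nrm_embed_norm /r; lra.
have nXY : nrm (X - Y) <= d * r.
  have -> : X - Y = ((x - y) + (x' - y')) / 2 by rewrite /X /Y; ring.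
  rewrite n2V ler_pdivrMr // (le_trans (nrmD _ _)) //.
  by rewrite /r; lra.
pose A := Y - embed r.
pose B := (X + Y) / 2 - embed r.
have nA : nrm A <= 2 * d * r.
  have -> : A = (X - embed r) - (X - Y) by rewrite /A; ring.
  by rewrite (le_trans (nrmB _ _)) //; lra.
have nB : nrm B <= 2 * d * r.
  have -> : B = (X - embed r) - (X - Y) / 2 by rewrite /B; field.
  by rewrite (le_trans (nrmB _ _)) // n2V; have := nrm_ge0 (X - Y); lra.
set e1 := (X in _ <= nrm X); set p1 := (X in nrm X <= nrm e1).
have e1E : e1 = embed (1 + r) * e + (A * e + (X - Y) * (p - e) / 2 + S * (p + e) / 2).
  have -> : embed (1 + r) = 1 + embed r by rewrite /embed rmorphD rmorph1.
  by rewrite /e1 /A /S /p /e /X /Y; field.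
have p1E : p1 = embed (1 - 2 * r) * p + embed r * e
   + (B * e - (A + B) * p + S * (p + e) / 2).
  have -> : embed (1 - 2 * r) = 1 - 2 * embed r.
    by rewrite /embed rmorphB rmorphM rmorph1 rmorph_nat.
  by rewrite /p1 /A /B /S /p /e /X /Y; field.
have np := nrm_ge0 p; have ne := nrm_ge0 e.
have nSpe : nrm (S * (p + e) / 2) <= 16 * a * d * r * nrm e.
  have t1 : nrm (p + e) <= 2 * nrm e by rewrite (le_trans (nrmD _ _)) //; lra.
  have : nrm (S * (p + e)) <= 16 * a * d * r * (2 * nrm e).
    by rewrite nrmM ler_pM ?nrm_ge0.
  by rewrite n2V; lra.
have nz z w c : nrm z <= c -> nrm w <= nrm e -> nrm (z * w) <= c * nrm e.
  by move=> ? ?; rewrite nrmM ler_pM ?nrm_ge0.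
have ee := lexx (nrm e).
have npe : nrm (p - e) <= 2 * nrm e.
  by rewrite (le_trans (nrmB _ _)) //; lra.
have E1 : nrm (A * e + (X - Y) * (p - e) / 2 + S * (p + e) / 2)
    <= (3 + 16 * a) * d * r * nrm e.
  have t1 : nrm ((X - Y) * (p - e) / 2) <= d * r * nrm e.
    have : nrm ((X - Y) * (p - e)) <= d * r * (2 * nrm e).
      by rewrite nrmM ler_pM ?nrm_ge0.
    by rewrite n2V; lra.
  have := nrmD (A * e + (X - Y) * (p - e) / 2) (S * (p + e) / 2).
  have := nrmD (A * e) ((X - Y) * (p - e) / 2).
  by have := nz _ _ _ nA ee; lra.
have E2 : nrm (B * e - (A + B) * p + S * (p + e) / 2)
    <= (6 + 16 * a) * d * r * nrm e.
  have nAB : nrm (A + B) <= 4 * d * r by rewrite (le_trans (nrmD _ _)) //; lra.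
  have := nrmD (B * e - (A + B) * p) (S * (p + e) / 2).
  have := nrmB (B * e) ((A + B) * p).
  by have := nz _ _ _ nB ee; have := nz _ _ _ nAB pe; lra.
(* Both coefficients are at most $24(1+a)$, so the smallness of [d] bounds each error by
   $r|e|/2$. *)
have da1 : (3 + 16 * a) * d <= 1 / 2 by nra.
have da2 : (6 + 16 * a) * d <= 1 / 2 by nra.
clear da nS nX nXY nA nB nSpe npe XE cx0 cx0' nx nx' h1 h1' h2 h2' h3 h3' n2V.
have L1 : (1 + r / 2) * nrm e <= nrm e1.
  have : nrm (embed (1 + r) * e) <= nrm e1
      + nrm (A * e + (X - Y) * (p - e) / 2 + S * (p + e) / 2).
    by rewrite (le_trans _ (nrmB _ _)) // e1E addrK.
  rewrite nrmM nrm_embed; last by lra.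
  have : (3 + 16 * a) * d * (r * nrm e) <= 1 / 2 * (r * nrm e).
    by apply: ler_wpM2r da1; rewrite mulr_ge0.
  by lra.
have L2 : nrm p1 <= nrm e.
  have : nrm p1 <= nrm (embed (1 - 2 * r) * p + embed r * e)
      + nrm (B * e - (A + B) * p + S * (p + e) / 2).
    by rewrite p1E nrmD.
  have := nrmD (embed (1 - 2 * r) * p) (embed r * e).
  rewrite !nrmM nrm_embed; last by lra.
  rewrite nrm_embed //.
  have : (6 + 16 * a) * d * (r * nrm e) <= 1 / 2 * (r * nrm e).
    by apply: ler_wpM2r da2; rewrite mulr_ge0.
  have : (1 - 2 * r) * nrm p <= (1 - 2 * r) * nrm e by rewrite ler_wpM2l //; lra.
  have : 0 <= r * nrm e by rewrite mulr_ge0.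
  by lra.
have re0 : 0 <= r * nrm e by rewrite mulr_ge0.
have L3 : nrm e <= nrm e1 by lra.
by split => //; exact: le_trans L3.
Qed.

End Cone.

Lemma cvgX (K : numFieldType) (T : Type) (F : set_system T) {FF : Filter F}
    (f : T -> K) (l : K) (n : nat) :
  f x @[x --> F] --> l -> (f x ^+ n) @[x --> F] --> l ^+ n.
Proof.
move=> fl; elim: n => [|n IH]; first by under eq_fun do rewrite expr0; exact: cvg_cst.
by under eq_fun do rewrite exprS; rewrite exprS; apply: cvgM.
Qed.

(* The shape of the limit decides which continuity lemma to use; hypotheses are
   compared with the goal syntactically, since testing distinct terms of C R for
   convertibility may take forever. *)
Ltac cvg_alg := repeat lazymatch goal with
  | |- cvg_to (nbhs (fmap (fun _ => ?c) _)) _ => exact: cvg_cst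
  | |- cvg_to _ (nbhs (_ + _)) => apply: cvgD
  | |- cvg_to _ (nbhs (- _)) => apply: cvgN
  | |- cvg_to _ (nbhs (_ * _)) => apply: cvgM
  | |- cvg_to _ (nbhs (_ ^+ _)) => apply: cvgX
  | |- cvg_to _ (nbhs (_ ^-1)) => apply: cvgV
  | |- cvg_to (nbhs (fmap ?g _)) (nbhs ?l) => match goal with
      | H : cvg_to (nbhs (fmap ?f _)) (nbhs ?m) |- _ =>
        first [constr_eq l m | lazymatch l with 0 => lazymatch m with 0 => idtac end end
              | lazymatch l with 1 => lazymatch m with 1 => idtac end end
              | lazymatch l with ?n%:R => lazymatch m with n%:R => idtac end end];
        let f0 := eval cbv beta in (f 0%N) in
        let g0 := eval cbv beta in (g 0%N) in
        constr_eq f0 g0; exact: H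
      end
  end.

(** Typical use: [m] is the expression of [g] with each sequence replaced by its limit, so that
    [cvg_alg] can follow its shape. *)
Lemma cvg_seq_eq (R : realType) (f g : nat -> C R) (l m : C R) :
  (forall n, f n = g n) -> l = m -> g n @[n --> \oo] --> m -> f n @[n --> \oo] --> l.
Proof. by move=> /funext -> ->. Qed.

Lemma cvg_seq_near (R : realType) (f g : nat -> C R) (l : C R) :
  (\forall n \near \oo, f n = g n) -> g n @[n --> \oo] --> l ->
  f n @[n --> \oo] --> l.
Proof.
move=> fg gl; apply: cvg_trans gl; apply: near_eq_cvg.
by apply: filterS fg.
Qed.

(** * The degenerate direction *)

Section Lyapunov.
Variable R : realType.
Implicit Types (s G W e f : nat -> C R).

Lemma shift_cvg (u : nat -> C R) (l : C R) :
  u n @[n --> \oo] --> l -> u n.+1 @[n --> \oo] --> l.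
Proof. by rewrite -(@cvg_shiftS _ u). Qed.

Lemma shift_cvgn (u : nat -> C R) (l : C R) N :
  u @ \oo --> l -> u (n + N)%N @[n --> \oo] --> l.
Proof. by rewrite -(@cvg_shiftn N _ u). Qed.

(** The sequence can get below [m] only by a jump from above [m], of size at most 1, and does not
    decrease from there. Applied to $\mathrm{Re}\,J$. *)
Lemma eventually_monotone_ge (P : nat -> R) (N : nat) (m : R) :
  (forall n, (N <= n)%N -> P n <= m -> P n <= P n.+1) ->
  (forall n, (N <= n)%N -> P n - 1 <= P n.+1) ->
  forall n, (N <= n)%N -> Num.min (P N) (m - 1) <= P n.
Proof.
move=> mono step n /subnK <-; elim: (n - N)%N => [|k IH].
  by rewrite add0n ge_min lexx.
have Nk : (N <= k + N)%N by rewrite leq_addl.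
have [Pm|Pm] := leP (P (k + N)%N) m.
  by rewrite addSn (le_trans IH) // mono.
by rewrite addSn (le_trans _ (step _ Nk)) // ge_min lerD2r (ltW Pm) orbT.
Qed.

(** In the application $c=\mathrm{Re}\,s$, $r=|s|$, $t$ is $2/a$ times the increment of
    $\mathrm{Re}\,J$, and $1+T$ is the factor of $|W|^2$. The terms $-2c$ agree, and the quadratic
    term of $e^t$ is about $2c^2\le2dr^2$, so the surplus $2ar^2$ in $T$ prevails. *)
Lemma lyapunov_step (a d c r t T : R) : 0 < a -> 0 < d ->
   100 * d * (1 + a + a^-1) ^+ 2 <= a -> 0 <= r -> r <= d -> c ^+ 2 <= d * r ^+ 2 ->
   `|c| <= r ->
   -2 * c + 2 * a * (1 - 2 * d) * r ^+ 2 - 2 * d * r ^+ 2 <= T ->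
   t <= - 2 * c + 2 / a * d * r ^+ 2 ->
   expR t <= 1 + T.
Proof.
move=> a0 d0; set K := 1 + a + a^-1 => dK r0 rd cr cr' LT Lt.
have b0 : 0 < a^-1 by rewrite invr_gt0.
set b := a^-1 in K dK Lt b0 *; clearbody b.
have K1 : 1 <= K by rewrite /K; lra.
have Ka : a <= K by rewrite /K; lra.
have Kb : b <= K by rewrite /K; lra.
clearbody K.
have KK : K <= K ^+ 2 by rewrite expr2 ler_peMl //; lra.
have dK3 : d * K <= 1 / 100.
  have K0 : 0 < K by lra.
  by rewrite -(ler_pM2r K0); move: dK; rewrite expr2; lra.
have dK2 : d * K <= a / 100 by have := ler_wpM2l (ltW d0) KK; lra.
have aK : d * a <= d * K by rewrite ler_wpM2l // ltW.
have bK : d * b <= d * K by rewrite ler_wpM2l // ltW.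
have d1 : d <= 1 / 100 by rewrite -(ler_pM2r a0); lra.
pose A0 := 2 * a * (1 - 2 * d) - 2 * d; pose B0 := 2 * b * d.
have dK' : d <= d * K by rewrite ler_peMr // ltW.
have da : d * a <= a / 100 by lra.
have da1 : d <= a / 100 by lra.
have db : d * b <= a / 100 by lra.
have db1 : d * b <= 1 / 100 by lra.
clear K dK K1 Ka Kb KK dK2 dK3 aK bK dK'.
pose q := r ^+ 2; have q0 : 0 <= q by rewrite sqr_ge0.
have qd : q <= d / 100.
  rewrite /q expr2 (le_trans (ler_pM r0 r0 rd rd)) //.
  by have := ler_wpM2l (ltW d0) d1; lra.
have B0K : 0 <= B0 <= a / 50.
  apply/andP; split; first by rewrite !mulr_ge0 // ltW.
  by rewrite /B0; lra.
have A0K : 0 <= A0 <= 2 * a.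
  have : 0 <= d * a by rewrite mulr_ge0 // ltW.
  by rewrite /A0; lra.
pose T0 := - 2 * c + A0 * q; pose t0 := - 2 * c + B0 * q.
have TT0 : T0 <= T by rewrite /T0 /A0 /q; lra.
have tt0 : t <= t0.
  apply: le_trans Lt _; rewrite /t0 /B0 /q; lra.
have := ler_normlP _ _ cr' => -[c1 c2].
have AB : A0 - B0 >= 3 / 2 * a.
  by move: B0K A0K; rewrite /A0; lra.
have qB : B0 * q <= a / 50 * q by rewrite ler_wpM2r //; lra.
have qA : A0 * q <= 2 * a * q by rewrite ler_wpM2r //; lra.
have B0K1 : B0 <= 1 / 50 by rewrite /B0; lra.
have qB1 : B0 * q <= 1 / 50 * q by rewrite ler_wpM2r.
have t0lt : t0 < 1 by rewrite /t0; lra.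
rewrite -/q in cr; clear LT Lt B0K1 b0 db db1; clearbody q A0 B0.
case/andP: A0K => A0p A0l; case/andP: B0K => B0p B0l.
have A0q : 0 <= A0 * q by rewrite mulr_ge0.
have B0q : 0 <= B0 * q by rewrite mulr_ge0.
have C1 : - c * ((A0 + B0) * q) <= d * ((A0 + B0) * q).
  by rewrite ler_wpM2r ?mulr_ge0 //; lra.
have C2 : d * (A0 * q) <= d * (2 * a * q) by rewrite ler_wpM2l // ltW.
have C3 : d * (B0 * q) <= d * (a / 50 * q) by rewrite ler_wpM2l // ltW.
have C4 : d * a * q <= a / 100 * q by rewrite ler_wpM2r.
have C5 : A0 * q * (B0 * q) <= 2 * a * q * (1 / 50 * q) by rewrite ler_pM.
have C6 : a * q * q <= a * q * (1 / 100).
  by rewrite ler_wpM2l ?mulr_ge0 ?(ltW a0) //; lra.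
have C7 : d * q <= a / 100 * q by rewrite ler_wpM2r.
have C8 : 3 / 2 * a * q <= (A0 - B0) * q by rewrite ler_wpM2r.
have C9 : 0 <= a * q by rewrite mulr_ge0 // ltW.
(* The terms $-2c$ cancel in the product; the gain $(A_0-B_0)q\ge\frac32aq$ exceeds $4c^2\le4dq$ and
   the higher products. *)
have key : 1 <= (1 + T0) * (1 - t0) by rewrite /T0 /t0; lra.
apply: (@le_trans _ _ (expR t0)); first by rewrite ler_expR.
apply: (@le_trans _ _ (1 + T0)); last by rewrite lerD2l.
have e1 : 1 - t0 <= expR (- t0) by exact: expR_ge1Dx.
have t1 : 0 < 1 - t0 by rewrite subr_gt0.
have T1 : 0 < 1 + T0.
  by rewrite -(pmulr_lgt0 _ t1) (lt_le_trans _ key).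
(* $e^{t_0}=1/e^{-t_0}\le1/(1-t_0)\le1+T_0$. *)
rewrite -[leLHS]invrK -expRN -[leRHS]invrK lef_pV2 ?posrE ?invr_gt0 ?expR_gt0 //.
by rewrite (le_trans _ e1) // -[leLHS]mul1r ler_pdivrMr // mulrC.
Qed.

(** With $J=1/s+G$, Cesàro gives $J_n^2/n\to-2a$. Since $sJ=1+sG\to1$, the product $ns_n^2$ tends to
    the negative real $-1/(2a)$, so $s_n$ is close to the imaginary axis relative to its norm. *)
Lemma nearly_imaginary (a : R) s G e : 0 < a -> (forall n, s n != 0) ->
  s @ \oo --> (0 : C R) -> G @ \oo --> (0 : C R) -> e @ \oo --> (0 : C R) ->
  (forall n, (s n.+1)^-1 + G n.+1
     = (s n)^-1 + G n - embed a * s n + s n ^+ 2 * e n) ->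
  forall d : R, 0 < d ->
    \forall n \near \oo, cre (s n.+1) ^+ 2 <= d * nrm (s n.+1) ^+ 2.
Proof.
move=> a0 sN0 s0 G0 e0 rec d d0.
pose J n := (s n)^-1 + G n.
have dJ : (J n.+1 ^+ 2 - J n ^+ 2) @[n --> \oo] --> - (2 * embed a).
  (* The factors are $(J_{n+1}-J_n)/s_n$ and $s_n(J_{n+1}+J_n)$, both regular at $s=0$. *)
  have E n : J n.+1 ^+ 2 - J n ^+ 2 = (- embed a + s n * e n)
      * (2 + 2 * (s n * G n) - embed a * s n ^+ 2 + s n ^+ 3 * e n).
    by rewrite /J rec; field.
  apply: (cvg_seq_eq E (_ : _ = (- embed a + 0 * 0)
    * (2 + 2 * (0 * 0) - embed a * 0 ^+ 2 + 0 ^+ 3 * 0))); first by ring.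
  by cvg_alg.
have aN0 : embed a != 0 :> C R by rewrite gt_eqF // embed_gt0.
have two0 : (2 : C R) != 0 by rewrite pnatr_eq0.
move/cesaro_complex in dJ; move: dJ => /(cvgV _).
rewrite oppr_eq0 mulf_neq0 // => /(_ isT) iJ.
have sJ : ((1 + s n.+1 * G n.+1) ^+ 2) @[n --> \oo] --> (1 : C R).
  have s1 := shift_cvg s0; have G1 := shift_cvg G0.
  apply: (cvg_seq_eq (fun=> erefl) (_ : _ = (1 + 0 * 0) ^+ 2)); first by ring.
  by cvg_alg.
pose L := (2 * a)^-1; have L0 : 0 < L by rewrite invr_gt0 mulr_gt0.
have rho : (s n.+1 ^+ 2 * n.+1%:R) @[n --> \oo] --> - embed L.
  have lim : ((1 + s n.+1 * G n.+1) ^+ 2 * (J n.+1 ^+ 2 / n.+1%:R)^-1)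
      @[n --> \oo] --> - embed L.
    apply: (cvg_seq_eq (fun=> erefl)) (cvgM sJ iJ).
    by rewrite mul1r invrN embedV embedM embed_nat.
  apply: (cvg_seq_near _ lim).
  apply: filterS (cvg_near_nrm ltr01 sJ) => n.
  have n0 : n.+1%:R != 0 :> C R by rewrite pnatr_eq0.
  have sn0 := sN0 n.+1; rewrite /= /J => H.
  have J0 : 1 + s n.+1 * G n.+1 != 0.
    by apply: contraTN H => /eqP ->; rewrite expr0n /= sub0r nrmN nrm1 ltxx.
  by field; rewrite sn0 addrC natr1 n0 mulrC.
(* The radius $\varepsilon=Ld/(1+d)$ solves $d(L-\varepsilon)=\varepsilon$. If $Nz^2$ is within
   $\varepsilon$ of $-L$, then
   $2N(\mathrm{Re}\,z)^2=\mathrm{Re}(Nz^2)+N|z|^2<2\varepsilon=2d(L-\varepsilon)<2dN|z|^2$. *)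
apply: filterS (cvg_near_nrm (_ : 0 < L * d / (1 + d)) rho); last first.
  by rewrite divr_gt0 ?mulr_gt0 // addr_gt0.
move=> n; set z := s n.+1; set ep := L * d / (1 + d); rewrite opprK => H.
have epE : d * (L - ep) = ep by rewrite /ep; field; lra.
pose N : R := n.+1%:R; have N0 : 0 < N by rewrite ltr0n.
have zN : z ^+ 2 * n.+1%:R = embed N * z ^+ 2 by rewrite /N embed_nat mulrC.
have nL : nrm (embed L) = L by rewrite nrm_embed // ltW.
rewrite zN in H.
have H1 : cre (embed N * z ^+ 2) + L < ep.
  have -> : L = cre (embed L) by [].
  by rewrite -creD (le_lt_trans _ H) // (le_trans (ler_norm _)) // cre_nrm.
have H2 : nrm (embed N * z ^+ 2) < L + ep.
  have := nrmB (embed N * z ^+ 2 + embed L) (embed L); rewrite addrK nL.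
  by lra.
have H3 : L - ep < nrm (embed N * z ^+ 2).
  have := nrmB (embed N * z ^+ 2 + embed L) (embed N * z ^+ 2).
  rewrite addrAC subrr add0r nL ltrBlDr => Hl.
  by rewrite (le_lt_trans Hl) // addrC ltrD2l.
move: H1 H2 H3; rewrite creM_embed nrmM nrm_embed ?ler0n // nrmX cre_sqr => H1 H2 H3.
have q : N * nrm z ^+ 2 = N * (cre z ^+ 2 + cim z ^+ 2) by rewrite sqr_nrm.
have H4 : d * (L - ep) < d * (N * nrm z ^+ 2) by rewrite ltr_pM2l.
by rewrite -(ler_pM2l N0); lra.
Qed.

(* [W] cannot tend to 0: eventually Re J >= const, where J = 1 / s + G, and
   expR (- 2 / a * Re J) * |W|^2 increases. *)
Lemma no_degenerate_orbit (a : R) s G W e f : 0 < a ->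
  (forall n, s n != 0) -> (forall n, W n != 0) ->
  s @ \oo --> (0 : C R) -> G @ \oo --> (0 : C R) -> W @ \oo --> (0 : C R) ->
  e @ \oo --> (0 : C R) -> f @ \oo --> (0 : C R) ->
  (forall n, (s n.+1)^-1 + G n.+1
     = (s n)^-1 + G n - embed a * s n + s n ^+ 2 * e n) ->
  (forall n, W n.+1
     = W n * (1 - s n - embed a * s n ^+ 2 + s n ^+ 2 * f n)) ->
  False.
Proof.
move=> a0 sN0 WN0 s0 G0 W0 e0 f0 recJ recW.
have K0 : 0 < 1 + a + a^-1 by rewrite !addr_gt0 ?invr_gt0.
(* The first bound serves [lyapunov_step]; $d\le a/2$ makes $\mathrm{Re}\,J$ nondecreasing where it
   is at most $-1$; the other two keep its drop in one step below 1. *)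
pose d := Num.min (Num.min (a / 100 / (1 + a + a^-1) ^+ 2) (1 / 2))
  (Num.min (a / 2) (a^-1 / 4)).
have d0 : 0 < d by rewrite !lt_min !divr_gt0 ?exprn_gt0 ?invr_gt0.
have dle : 100 * d * (1 + a + a^-1) ^+ 2 <= a.
  have : d <= a / 100 / (1 + a + a^-1) ^+ 2 by rewrite !ge_min lexx.
  by rewrite ler_pdivlMr ?exprn_gt0 //; lra.
have d2 : d <= 1 / 2 by rewrite !ge_min lexx orbT.
have da : d <= a / 2 by rewrite !ge_min lexx !orbT.
have ad : a * d <= 1 / 4.
  have : d <= a^-1 / 4 by rewrite !ge_min lexx !orbT.
  by rewrite -(ler_pM2l a0) mulrA divff ?gt_eqF.
have small (u : nat -> C R) (ep : R) : 0 < ep -> u @ \oo --> (0 : C R) ->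
    \forall n \near \oo, nrm (u n) <= ep.
  move=> ep0 u0; apply: filterS (cvg_near_nrm ep0 u0) => n.
  by rewrite subr0 => /ltW.
have im : \forall n \near \oo, cre (s n) ^+ 2 <= d * nrm (s n) ^+ 2.
  have [M _ HM] := nearly_imaginary a0 sN0 s0 G0 e0 recJ d0.
  by exists M.+1 => // -[//|m]; apply: HM.
have half0 : 0 < 1 / 2 :> R by lra.
have [N _ HN] : \forall n \near \oo,
  [/\ cre (s n) ^+ 2 <= d * nrm (s n) ^+ 2, nrm (s n) <= d,
      nrm (e n) <= d, nrm (f n) <= d & nrm (G n) <= 1 / 2].
  near=> n; split; near: n => //; exact: small.
pose P n := cre ((s n)^-1 + G n).
have dP n : P n.+1 = P n - a * cre (s n) + cre (s n ^+ 2 * e n).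
  by rewrite /P recJ creD creB creM_embed.
have sq n : (N <= n)%N -> nrm (s n) ^+ 2 <= d * d.
  by move=> /HN[_ ? _ _ _]; rewrite expr2 ler_pM ?nrm_ge0.
have de n : (N <= n)%N -> `|cre (s n ^+ 2 * e n)| <= d * nrm (s n) ^+ 2.
  move=> /HN[_ _ ? _ _]; apply: le_trans (cre_nrm _) _.
  by rewrite nrmM nrmX mulrC ler_wpM2r ?sqr_ge0.
(* If $\mathrm{Re}\,J\le-1$ and $|G|\le1/2$, then $\mathrm{Re}(1/s)\le-1/2$, that is
   $\mathrm{Re}\,s\le-|s|^2/2$: the term $-a\,\mathrm{Re}\,s$ then outweighs the error $d|s|^2$. *)
have Pge n : (N <= n)%N -> Num.min (P N) (- 1 - 1) <= P n.
  apply: eventually_monotone_ge => {}n Nn; have [c2 sd ed fd Gd] := HN _ Nn.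
    move=> Pn; move: (Pn); rewrite {1}/P creD cre_inv dP => Pn'.
    have := de _ Nn; rewrite ler_norml => /andP[de1 _].
    have s2 : 0 < nrm (s n) ^+ 2 by rewrite exprn_gt0 // nrm_gt0.
    have := le_trans (cre_nrm _) Gd; rewrite ler_norml => /andP[G1 _].
    have : cre (s n) / nrm (s n) ^+ 2 <= - 1 / 2 by lra.
    rewrite ler_pdivrMr // => cs.
    have acs : a * cre (s n) <= a * (- 1 / 2 * nrm (s n) ^+ 2) by rewrite ler_pM2l.
    have ds : d * nrm (s n) ^+ 2 <= a / 2 * nrm (s n) ^+ 2 by rewrite ler_pM2r.
    lra.
  have as' : a * cre (s n) <= a * d.
    by rewrite ler_pM2l // (le_trans _ sd) // (le_trans (ler_norm _)) // cre_nrm.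
  have := de _ Nn; rewrite ler_norml => /andP[de1 _].
  have : d * nrm (s n) ^+ 2 <= 1 / 2 * (1 / 2 * (1 / 2)).
    rewrite ler_pM ?sqr_ge0 ?(ltW d0) // (le_trans (sq _ Nn)) //.
    by rewrite ler_pM // ltW.
  by rewrite dP; lra.
pose V n := expR (- (2 / a) * P n) * nrm (W n) ^+ 2.
have Vmono n : (N <= n)%N -> V n <= V n.+1.
  move=> Nn; have [c2 sd ed fd _] := HN _ Nn.
  have dW : nrm (W n.+1) ^+ 2 = nrm (W n) ^+ 2
      * nrm (1 - s n - embed a * s n ^+ 2 + s n ^+ 2 * f n) ^+ 2.
    by rewrite recW nrmM exprMn.
  pose t := 2 / a * (P n.+1 - P n).
  have step : expR t <= nrm (1 - s n - embed a * s n ^+ 2 + s n ^+ 2 * f n) ^+ 2.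
    rewrite -[leRHS](subrKC 1).
    apply: (lyapunov_step a0 d0 dle (nrm_ge0 (s n)) sd c2 (cre_nrm _)).
      (* The lower bound on $T$ comes from $|w|^2\ge1+2(\mathrm{Re}\,w-1)$ and
         $\mathrm{Re}(s^2)\le(2d-1)|s|^2$. *)
      set w := 1 - s n - _ + _.
      have wE : cre w = 1 - cre (s n) - a * cre (s n ^+ 2) + cre (s n ^+ 2 * f n).
        by rewrite /w !(creD, creN) creM_embed.
      have sf : `|cre (s n ^+ 2 * f n)| <= d * nrm (s n) ^+ 2.
        apply: le_trans (cre_nrm _) _.
        by rewrite nrmM nrmX mulrC ler_wpM2r ?sqr_ge0.
      move: sf; rewrite ler_norml => /andP[sf _].
      have s2 : cre (s n ^+ 2) <= (2 * d - 1) * nrm (s n) ^+ 2.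
        by rewrite cre_sqr; have := sqr_nrm (s n); lra.
      have as2 : a * cre (s n ^+ 2) <= a * ((2 * d - 1) * nrm (s n) ^+ 2).
        by rewrite ler_pM2l.
      have : 1 + 2 * (cre w - 1) <= nrm w ^+ 2.
        have := sqr_ge0 (cre w - 1); have := sqr_ge0 (cim w).
        by rewrite sqr_nrm; lra.
      by rewrite wE; lra.
    have := de _ Nn; rewrite ler_norml => /andP[_ de2].
    have de3 : 2 / a * cre (s n ^+ 2 * e n) <= 2 / a * (d * nrm (s n) ^+ 2).
      by rewrite ler_wpM2l // divr_ge0 // ltW.
    have -> : t = - 2 * cre (s n) + 2 / a * cre (s n ^+ 2 * e n).
      by rewrite /t dP; field; rewrite gt_eqF.
    by lra.
  have -> : V n = expR (- (2 / a) * P n.+1) * (nrm (W n) ^+ 2 * expR t).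
    rewrite [_ * expR t]mulrC mulrA -expRD /V; congr (expR _ * _).
    by rewrite /t; ring.
  by rewrite /V dW ler_wpM2l ?expR_ge0 // ler_wpM2l ?sqr_ge0.
have VN n : (N <= n)%N -> V N <= V n.
  move=> /subnK <-; elim: (n - N)%N => [//|k IH].
  by rewrite (le_trans IH) // addSn Vmono // leq_addl.
have V0 : 0 < V N by rewrite mulr_gt0 ?expR_gt0 // exprn_gt0 // nrm_gt0.
pose m := Num.min (P N) (- 1 - 1).
pose E := expR (- (2 / a) * m); have E0 : 0 < E by exact: expR_gt0.
(* The bound 1 gives $|W_k|^2\le|W_k|$; with $P_k\ge m$ this yields $V_k\le E|W_k|^2<V_N$, against
   the growth of [V]. *)
have ep0 : 0 < Num.min 1 (V N / E / 2) by rewrite lt_min ltr01 !divr_gt0.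
have [M _ HM] := small _ _ ep0 W0.
have := HM (maxn N M) (leq_maxr _ _); set k := maxn N M.
have Nk : (N <= k)%N by exact: leq_maxl.
rewrite le_min => /andP[w1 w2].
have := VN _ Nk; rewrite leNgt => /negP; apply.
have : nrm (W k) ^+ 2 < V N / E.
  have : 0 < V N / E by rewrite divr_gt0.
  have : nrm (W k) ^+ 2 <= nrm (W k) by rewrite expr2 ler_piMl ?nrm_ge0.
  lra.
rewrite ltr_pdivlMr // mulrC; apply: le_lt_trans.
rewrite /V ler_wpM2r ?sqr_ge0 // ler_expR !mulNr lerN2.
by rewrite ler_wpM2l ?Pge // divr_ge0 // ltW.
Unshelve. all: by end_near. Qed.
End Lyapunov.

(** * Algebraic identities for one step in the degenerate direction *)

Section Degenerate.
Variable R : realType.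

(* One step of h in the coordinates [s] and [k] with x = s k and
   y^2 = s^2 (k^2 - 1); the new value of [s] is [s * q]. The polynomial [G]
   solves G' (1 - k^2) = a (k^4 - 1) - (k^2 - 1) / 2, which cancels the terms of
   order [s] that vanish at k = 1. *)
Lemma degenerate_energy_step (F : numFieldType) (a s k p q k1 : F) :
  s != 0 -> q != 0 -> q = 1 + s ^+ 2 * p ->
  p * (2 + s ^+ 2 * p) = - (k ^+ 2 - 1) + 2 * a * k ^+ 4
    - 2 * a * s * k ^+ 3 * (k ^+ 2 - 1) + a ^+ 2 * s ^+ 2 * k ^+ 6 ->
  k1 = (k - s * (k ^+ 2 - 1) + a * s ^+ 2 * k ^+ 3) / q ->
  let G z := z / 2 - a * z - a / 3 * z ^+ 3 + (4 / 3 * a - 1 / 2) in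
  let d := q^-1 * (- (k ^+ 2 - 1) + s * (a * k ^+ 3 - k * p)) in
  (s * q)^-1 + G k1 = s^-1 + G k - a * s + s ^+ 2 *
    (q^-1 * (a * k ^+ 3 * (k ^+ 2 - 1) - 2^-1 * (a ^+ 2 * s * k ^+ 6)
         + 2^-1 * (s * p ^+ 2) + a * s * p
         + (a * k ^+ 3 - k * p) * (2^-1 - a - a * k ^+ 2))
     + d ^+ 2 * (- a * k - 3^-1 * (a * s * d))).
Proof.
move=> s0 q0 qE pE k1E G d.
have k1d : k1 = k + s * d.
  apply: subr0_eq; rewrite k1E /d.
  rewrite (_ : _ - _ = k * (1 + s ^+ 2 * p - q) / q); last by field.
  by rewrite -qE subrr mulr0 mul0r.
apply: subr0_eq; rewrite k1d /G.
set E := - (k ^+ 2 - 1) + _ - _ + _ in pE.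
(* The difference of the two sides is an explicit combination of the two relations [pE] and [qE],
   hence zero. *)
rewrite (_ : _ - _ = (E - p * (2 + s ^+ 2 * p)) * (s / (2 * q))
   + (1 + s ^+ 2 * p - q) * ((s * q)^-1 - a * s / q)).
  by rewrite pE -qE !subrr !mul0r addr0.
by rewrite /E /d; field; rewrite q0 s0.
Qed.

(* The left-hand side is the factor by which W = y / (s (k + 1)) is multiplied. *)
Lemma degenerate_phase_step (F : numFieldType) (a s k p q : F) :
  q = 1 + s ^+ 2 * p ->
  let D := k - s * (k ^+ 2 - 1) + a * s ^+ 2 * k ^+ 3 + q in D != 0 ->
  (1 - s * k) * (k + 1) / D = 1 - s - a * s ^+ 2 + s ^+ 2 *
    (D^-1 * (- (a * k ^+ 3 + p) - (k ^+ 2 - 1) + a * (k + 1)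
     + s * ((a * k ^+ 3 + p) - a * (k ^+ 2 - 1)) + s ^+ 2 * (a * (a * k ^+ 3 + p)))).
Proof. by move=> -> D D0; rewrite /D in D0 *; field. Qed.

End Degenerate.

(** * Orbits tangent to the x-axis *)

Section AlongX.
Variable R : realType.
Implicit Types (x y : nat -> C R).

Definition is_orbit (a : R) x y := forall n,
  x n.+1 = x n - y n ^+ 2 + embed a * x n ^+ 3 /\ y n.+1 = y n - x n * y n.

(** The root with non-negative real part satisfies $|1+s|\ge1$, so $|s-1|\le|s^2-1|=|u|^2$. *)
Lemma sqrt_near1 (u : nat -> C R) : u @ \oo --> (0 : C R) ->
  exists s : nat -> C R, [/\ s @ \oo --> (1 : C R),
    forall n, s n ^+ 2 = 1 - u n ^+ 2 & forall n, 1 + s n != 0].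
Proof.
move=> u0.
have /choice[s sP] n : exists z : C R, z ^+ 2 = 1 - u n ^+ 2 /\ 0 <= cre z.
  have [z0|/ltW z0] := leP 0 (cre (sqrtC (1 - u n ^+ 2))).
    by exists (sqrtC (1 - u n ^+ 2)); rewrite sqrtCK.
  by exists (- sqrtC (1 - u n ^+ 2)); rewrite sqrrN sqrtCK creN oppr_ge0.
have s1 n : 1 <= nrm (1 + s n).
  have [_ c0] := sP n; apply: le_trans (ler_norm _) _.
  apply: le_trans _ (cre_nrm _); rewrite creD.
  have -> : cre 1 = 1 by [].
  by rewrite normr1 ger0_norm ?lerDl // addr_ge0.
exists s; split; last 2 first.
- by move=> n; have [] := sP n.
- by move=> n; rewrite -nrm_gt0 (lt_le_trans ltr01).
apply: near_nrm_cvg => e e0.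
have uu : (u n ^+ 2) @[n --> \oo] --> (0 : C R).
  by apply: (cvg_seq_eq (fun=> erefl) (_ : _ = 0 ^+ 2)); [rewrite expr0n|cvg_alg].
apply: filterS (cvg_near_nrm e0 uu) => n; rewrite subr0; apply: le_lt_trans.
have -> : u n ^+ 2 = - ((s n - 1) * (1 + s n)).
  by have [e2 _] := sP n; rewrite -[LHS](subKr 1) -e2; ring.
by rewrite nrmN nrmM ler_peMr // nrm_ge0.
Qed.

(** Here [g] is the $\sigma$ of the outline, obtained as $x\sqrt{1-(y/x)^2}$, and $k=x/g$. The exact
    one-step identities then put the orbit in the form that [no_degenerate_orbit] excludes. *)
Lemma no_orbit_along_x (a : R) x y : 0 < a -> is_orbit a x y ->
  (forall n, x n != 0) -> (forall n, y n != 0) ->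
  x @ \oo --> (0 : C R) -> (y n / x n) @[n --> \oo] --> (0 : C R) -> False.
Proof.
move=> a0 orb xN0 yN0 x0 u0.
have [s [s1 s2 sp]] := sqrt_near1 u0.
set A := embed a in orb.
pose k n := (s n)^-1; pose g n := x n * s n.
have k1 : k @ \oo --> (1 : C R).
  by rewrite -[X in _ --> X]invr1; apply: cvgV.
have g0 : g @ \oo --> (0 : C R).
  apply: (cvg_seq_eq (fun=> erefl) (_ : _ = 0 * 1)); first by rewrite mul0r.
  by rewrite /g; cvg_alg.
pose q n := g n.+1 / g n.
have q1 : q @ \oo --> (1 : C R).
  have sS := shift_cvg s1.
  apply: (@cvg_seq_eq _ _
    (fun n => (1 - x n * (y n / x n) ^+ 2 + A * x n ^+ 2) * (s n.+1 * k n)) _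
    ((1 - 0 * 0 ^+ 2 + A * 0 ^+ 2) * (1 * 1))).
  - move=> n; rewrite /q /g /k invfM; have [-> _] := orb n.
    rewrite [LHS]mulrACA; congr (_ * _).
    by field.
  - by ring.
  - by cvg_alg.
pose E n := - (k n ^+ 2 - 1) + 2 * A * k n ^+ 4
    - 2 * A * g n * k n ^+ 3 * (k n ^+ 2 - 1) + A ^+ 2 * g n ^+ 2 * k n ^+ 6.
(* Since $q^2-1=g^2E$, this is $(q-1)/g^2$ without an indeterminate quotient; its limit is half that
   of [E]. *)
pose p n := E n * (1 + q n)^-1.
have two0 : (2 : C R) != 0 by rewrite pnatr_eq0.
have pA : p @ \oo --> A.
  apply: (cvg_seq_eq (fun=> erefl) (_ : _ = (- (1 ^+ 2 - 1) + 2 * A * 1 ^+ 4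
    - 2 * A * 0 * 1 ^+ 3 * (1 ^+ 2 - 1) + A ^+ 2 * 0 ^+ 2 * 1 ^+ 6) * (1 + 1)^-1)).
    by field.
  by rewrite /p /E; cvg_alg.
pose D n := k n - g n * (k n ^+ 2 - 1) + A * g n ^+ 2 * k n ^+ 3 + q n.
have D2 : D @ \oo --> (2 : C R).
  apply: (cvg_seq_eq (fun=> erefl)
    (_ : _ = 1 - 0 * (1 ^+ 2 - 1) + A * 0 ^+ 2 * 1 ^+ 3 + 1)); first by ring.
  by rewrite /D; cvg_alg.
pose d n := (q n)^-1 * (- (k n ^+ 2 - 1) + g n * (A * k n ^+ 3 - k n * p n)).
have d0 : d @ \oo --> (0 : C R).
  apply: (cvg_seq_eq (fun=> erefl)
    (_ : _ = 1^-1 * (- (1 ^+ 2 - 1) + 0 * (A * 1 ^+ 3 - 1 * A)))); first by ring.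
  by rewrite /d; cvg_alg; rewrite oner_neq0.
pose e n := (q n)^-1 * (A * k n ^+ 3 * (k n ^+ 2 - 1)
    - 2^-1 * (A ^+ 2 * g n * k n ^+ 6) + 2^-1 * (g n * p n ^+ 2) + A * g n * p n
    + (A * k n ^+ 3 - k n * p n) * (2^-1 - A - A * k n ^+ 2))
  + d n ^+ 2 * (- A * k n - 3^-1 * (A * g n * d n)).
have e0 : e @ \oo --> (0 : C R).
  apply: (cvg_seq_eq (fun=> erefl) (_ : _ = 1^-1 * (A * 1 ^+ 3 * (1 ^+ 2 - 1)
    - 2^-1 * (A ^+ 2 * 0 * 1 ^+ 6) + 2^-1 * (0 * A ^+ 2) + A * 0 * A
    + (A * 1 ^+ 3 - 1 * A) * (2^-1 - A - A * 1 ^+ 2))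
  + 0 ^+ 2 * (- A * 1 - 3^-1 * (A * 0 * 0)))); first by ring.
  by rewrite /e; cvg_alg; rewrite oner_neq0.
(* At $k=1$, $p=a$, $g=0$ the bracket is $-2a+2a=0$: this confirms the coefficient $-a$ of $s^2$ in
   the factor of $W$. *)
pose f n := (D n)^-1 * (- (A * k n ^+ 3 + p n) - (k n ^+ 2 - 1) + A * (k n + 1)
     + g n * ((A * k n ^+ 3 + p n) - A * (k n ^+ 2 - 1))
     + g n ^+ 2 * (A * (A * k n ^+ 3 + p n))).
have f0 : f @ \oo --> (0 : C R).
  apply: (cvg_seq_eq (fun=> erefl) (_ : _ = 2^-1 * (- (A * 1 ^+ 3 + A)
     - (1 ^+ 2 - 1) + A * (1 + 1) + 0 * ((A * 1 ^+ 3 + A) - A * (1 ^+ 2 - 1))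
     + 0 ^+ 2 * (A * (A * 1 ^+ 3 + A))))); first by ring.
  by rewrite /f; cvg_alg; rewrite two0.
pose G n := k n / 2 - A * k n - A / 3 * k n ^+ 3 + (4 / 3 * A - 1 / 2).
have G0 : G @ \oo --> (0 : C R).
  apply: (cvg_seq_eq (fun=> erefl) (_ : _ = 1 / 2 - A * 1 - A / 3 * 1 ^+ 3
     + (4 / 3 * A - 1 / 2))); first by field.
  by rewrite /G; cvg_alg.
pose W n := y n / (g n * (k n + 1)).
(* From rank [N] on the denominators do not vanish and the identities hold; the sequences are
   therefore shifted by [N] at the end. *)
have [N _ HN] : \forall n \near \oo, [/\ s n != 0, q n != 0 & 1 + q n != 0].
  near=> n; split; near: n.
  - exact: cvg_near_neq0 s1 (oner_neq0 _).
  - exact: cvg_near_neq0 q1 (oner_neq0 _).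
  - have q2 : (1 + q n) @[n --> \oo] --> (1 + 1 : C R) by cvg_alg.
    exact: cvg_near_neq0 q2 two0.
have W0 : W @ \oo --> (0 : C R).
  apply: (@cvg_seq_near _ _ (fun n => y n / x n * (1 + s n)^-1)).
    exists N => // n /= /HN[sn _ _]; rewrite /W /g /k.
    by field; rewrite sp xN0 sn.
  apply: (cvg_seq_eq (fun=> erefl) (_ : _ = 0 * (1 + 1)^-1)); first by ring.
  by cvg_alg.
have gN n : (N <= n)%N -> g n != 0.
  by move=> /HN[sn _ _]; rewrite mulf_neq0.
have g2 n : g n ^+ 2 = x n ^+ 2 - y n ^+ 2.
  by rewrite /g exprMn s2; field.
have gS n : (N <= n)%N -> g n.+1 = g n * q n.
  by move=> /gN gn; rewrite /q mulrC divfK.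
have xk n : (N <= n)%N -> x n = g n * k n.
  by move=> /HN[sn _ _]; rewrite /g /k mulfK.
have y2 n : (N <= n)%N -> y n ^+ 2 = g n ^+ 2 * (k n ^+ 2 - 1).
  by move=> Nn; rewrite mulrBr mulr1 -exprMn -xk // g2 subKr.
have x1 n : (N <= n)%N ->
    x n.+1 = g n * (k n - g n * (k n ^+ 2 - 1) + A * g n ^+ 2 * k n ^+ 3).
  move=> Nn; have [-> _] := orb n; rewrite (y2 n Nn) (xk n Nn).
  by move: (g n) (k n) => gn kn; ring.
have q2 n : (N <= n)%N -> q n ^+ 2 = 1 + g n ^+ 2 * E n.
  move=> Nn; have gn : g n ^+ 2 != 0 by rewrite expf_neq0 // gN.
  apply: (mulfI gn); rewrite -exprMn -gS // (g2 n.+1) x1 //; have [_ ->] := orb n.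
  have -> : (y n - x n * y n) ^+ 2 = y n ^+ 2 * (1 - x n) ^+ 2.
    by move: (x n) (y n) => xn yn; ring.
  rewrite y2 // xk // /E.
  by move: (g n) (k n) => {}gn kn; ring.
have qE n : (N <= n)%N -> q n = 1 + g n ^+ 2 * p n.
  move=> Nn; have [_ _ qn1] := HN _ Nn.
  have : g n ^+ 2 * E n = (q n - 1) * (1 + q n).
    by rewrite (addrC 1 (q n)) -subr_sqr_1 q2 // addrC addKr.
  by rewrite /p mulrA => ->; rewrite mulfK // subrKC.
have pE n : (N <= n)%N -> p n * (2 + g n ^+ 2 * p n) = E n.
  move=> Nn; have [_ _ qn1] := HN _ Nn.
  have -> : 2 + g n ^+ 2 * p n = 1 + q n by rewrite qE // addrA.
  by rewrite /p divfK.
have kE n : (N <= n)%N ->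
    k n.+1 = (k n - g n * (k n ^+ 2 - 1) + A * g n ^+ 2 * k n ^+ 3) / q n.
  move=> Nn; have [_ qn _] := HN _ Nn; have gn := gN _ Nn.
  have NS : (N <= n.+1)%N by rewrite leqW.
  apply: (mulfI (gN _ NS)); rewrite -xk // x1 // gS //.
  by rewrite [RHS]mulrACA divff // mulr1.
apply: (no_degenerate_orbit a0 _ _ (shift_cvgn N g0) (shift_cvgn N G0)
  (shift_cvgn N W0) (shift_cvgn N e0) (shift_cvgn N f0)).
- by move=> n; rewrite gN // leq_addl.
- move=> n; rewrite /W mulf_neq0 // invr_eq0 mulf_neq0 ?gN ?leq_addl //.
  have [sn _ _] := HN (n + N)%N (leq_addl _ _).
  rewrite /k; have -> : (s (n + N)%N)^-1 + 1 = (1 + s (n + N)%N) / s (n + N)%N.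
    by field.
  by rewrite mulf_neq0 // invr_eq0.
- move=> n; have := leq_addl n N; rewrite addSn; move: (n + N)%N => {}n Nn.
  have [_ qn _] := HN _ Nn.
  rewrite gS // /G.
  exact: (degenerate_energy_step (gN _ Nn) qn (qE _ Nn) (pE _ Nn) (kE _ Nn)).
- move=> n; have := leq_addl n N; rewrite addSn; move: (n + N)%N => {}n Nn.
  have [sn qn _] := HN _ Nn.
  have DE : D n = q n * (k n.+1 + 1).
    by rewrite kE // mulrDr mulr1 mulrC divfK.
  have k1N m : (N <= m)%N -> k m + 1 != 0.
    move=> /HN[sm _ _]; rewrite /k; have -> : (s m)^-1 + 1 = (1 + s m) / s m by field.
    by rewrite mulf_neq0 // invr_eq0.
  have NS : (N <= n.+1)%N by rewrite leqW.
  have D0 : D n != 0 by rewrite DE mulf_neq0 // k1N.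
  rewrite -(degenerate_phase_step (qE _ Nn) D0).
  have [_ yE] := orb n.
  rewrite {1}/W yE gS // -mulrA -DE xk // /W.
  have gn := gN _ Nn; have kn := k1N _ Nn.
  rewrite -/(D n).
  by move: (g n) (k n) (y n) (D n) gn kn D0 => gn kn yn Dn ? ? ?; field; apply/and3P.
Unshelve. all: by end_near. Qed.

End AlongX.

(** * The transversal directions *)

Section Transversal.
Variable R : realType.
Implicit Types (x y : nat -> C R).

(** Cesàro is applied to $1/y$ and to $Z=(x/y-w_0)/y$: $Z_n/n$ tends to $w_0^2-1$, but also to
    $(w_0-w_0)w_0=0$. *)
Lemma transversal_limit (a : R) x y (w0 : C R) : is_orbit a x y ->
  (forall n, y n != 0) -> x @ \oo --> (0 : C R) ->
  (x n / y n) @[n --> \oo] --> w0 ->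
  w0 ^+ 2 = 1 /\ ((y n.+1)^-1 / n.+1%:R) @[n --> \oo] --> w0.
Proof.
move=> orb yN0 x0 w1.
set A := embed a in orb.
have xN1 n : 1 - x n != 0.
  apply: contraNneq (yN0 n.+1) => e; have [_ ->] := orb n.
  by rewrite -{1}[y n]mul1r -mulrBl e mul0r.
have one0 : 1 - 0 != 0 :> C R by rewrite subr0 oner_neq0.
have dY : ((y n.+1)^-1 - (y n)^-1) @[n --> \oo] --> w0.
  apply: (@cvg_seq_eq _ _ (fun n => x n / y n * (1 - x n)^-1) _ (w0 * (1 - 0)^-1)).
  - move=> n; have [_ ->] := orb n.
    have -> : y n - x n * y n = y n * (1 - x n) by rewrite mulrBr mulr1 mulrC.
    by have := yN0 n; have := xN1 n; move: (x n) (y n) => xn yn ? ?; field; apply/andP.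
  - by rewrite subr0 invr1 mulr1.
  - by cvg_alg.
have Yn := cesaro_complex dY; split => //.
pose Z n := (x n / y n - w0) * (y n)^-1.
have dZ : (Z n.+1 - Z n) @[n --> \oo] --> w0 ^+ 2 - 1.
  apply: (@cvg_seq_eq _ _ (fun n => (x n / y n - w0) * (x n / y n) * (1 - x n)^-1
      + (- 1 + (x n / y n) ^+ 2 + A * (x n / y n) ^+ 2 * x n) * (1 - x n)^-1 ^+ 2)
    _ ((w0 - w0) * w0 * (1 - 0)^-1
      + (- 1 + w0 ^+ 2 + A * w0 ^+ 2 * 0) * (1 - 0)^-1 ^+ 2)).
  - move=> n; rewrite /Z; have [-> ->] := orb n.
    have -> : y n - x n * y n = y n * (1 - x n) by rewrite mulrBr mulr1 mulrC.
    by have := yN0 n; have := xN1 n; move: (x n) (y n) => xn yn ? ?; field; apply/andP.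
  - by rewrite subr0 invr1; ring.
  - by cvg_alg.
have Zn := cesaro_complex dZ.
have Z0 : (Z n.+1 / n.+1%:R) @[n --> \oo] --> (0 : C R).
  have wS := shift_cvg w1.
  apply: (@cvg_seq_eq _ _ (fun n => (x n.+1 / y n.+1 - w0) * ((y n.+1)^-1 / n.+1%:R))
    _ ((w0 - w0) * w0)).
  - by move=> n; rewrite /Z mulrA.
  - by rewrite subrr mul0r.
  - by apply: cvgM; [cvg_alg|exact: Yn].
by apply: subr0_eq; exact: cvg_unique Zn Z0.
Qed.

(** Since $ny_n\to1$ and $x_n/y_n\to1$, also $nx_n\to1$ and $n(x_n-y_n)\to0$; the conditions
    comparable to $\mathrm{Re}\,x$ are checked after multiplication by $n$. *)
Lemma eventually_sector (a d : R) x y : 0 < d -> is_orbit a x y ->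
  (forall n, y n != 0) -> x @ \oo --> (0 : C R) ->
  (x n / y n) @[n --> \oo] --> (1 : C R) ->
  \forall n \near \oo, sector d (x n) (y n).
Proof.
move=> d0 orb yN0 x0 w1.
have [_ Yn] := transversal_limit orb yN0 x0 w1.
have wS := shift_cvg w1.
have one0 : 1 != 0 :> C R by rewrite oner_neq0.
have yn : (n.+1%:R * y n.+1) @[n --> \oo] --> (1 : C R).
  apply: (@cvg_seq_eq _ _ (fun n => ((y n.+1)^-1 / n.+1%:R)^-1) _ 1^-1).
  - by move=> n; rewrite invfM !invrK mulrC.
  - by rewrite invr1.
  - exact: cvgV.
have xn : (n.+1%:R * x n.+1) @[n --> \oo] --> (1 : C R).
  apply: (@cvg_seq_eq _ _ (fun n => x n.+1 / y n.+1 * (n.+1%:R * y n.+1)) _ (1 * 1)).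
  - by move=> n; rewrite [RHS]mulrCA divfK.
  - by rewrite mulr1.
  - by cvg_alg.
have xyn : (n.+1%:R * (x n.+1 - y n.+1)) @[n --> \oo] --> (0 : C R).
  apply: (@cvg_seq_eq _ _ (fun n => n.+1%:R * x n.+1 - n.+1%:R * y n.+1) _ (1 - 1)).
  - by move=> n; rewrite mulrBr.
  - by rewrite subrr.
  - by cvg_alg.
(* The bound 1/2 gives $n\,\mathrm{Re}\,x_n>1/2$, hence
   $d\,n\,\mathrm{Re}\,x_n>d/2\ge\varepsilon$. *)
pose ep := Num.min (d / 2) (1 / 2).
have ep0 : 0 < ep by rewrite lt_min !divr_gt0.
have epd : ep <= d / 2 by rewrite ge_min lexx.
have ep2 : ep <= 1 / 2 by rewrite ge_min lexx orbT.
have xe := cvg_near_nrm ep0 xn; have xye := cvg_near_nrm ep0 xyn.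
have xd := cvg_near_nrm d0 (shift_cvg x0).
suff [N _ HN] : \forall n \near \oo, sector d (x n.+1) (y n.+1).
  by exists N.+1 => // -[//|m]; apply: HN.
near=> n.
have H1 : nrm (n.+1%:R * x n.+1 - 1) < ep by near: n; exact: xe.
have H2 : nrm (n.+1%:R * (x n.+1 - y n.+1) - 0) < ep by near: n; exact: xye.
have H3 : nrm (x n.+1 - 0) < d by near: n; exact: xd.
rewrite subr0 nrmM nrm_nat in H2; rewrite subr0 in H3.
have N0 : 0 < n.+1%:R :> R by rewrite ltr0n.
have nz (z : C R) : n.+1%:R * z = embed n.+1%:R * z by rewrite embed_nat.
have c1 : 1 - ep < n.+1%:R * cre (x n.+1).
  have := le_lt_trans (cre_nrm _) H1; rewrite nz creB creM_embed.
  have -> : cre 1 = 1 by [].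
  by rewrite ltr_norml => /andP[+ _]; lra.
have c2 : n.+1%:R * `|cim (x n.+1)| < ep.
  have := le_lt_trans (cim_nrm _) H1.
  have -> : cim (n.+1%:R * x n.+1 - 1) = n.+1%:R * cim (x n.+1).
    rewrite nz; case: (x n.+1) => [u v].
    by rewrite /cim /= mul0r oppr0 !addr0.
  by rewrite normrM gtr0_norm.
have dx : d / 2 < n.+1%:R * (d * cre (x n.+1)).
  rewrite mulrCA.
  have : d * (1 / 2) < d * (n.+1%:R * cre (x n.+1)) by rewrite ltr_pM2l //; lra.
  by lra.
split.
- by rewrite -(ler_pM2l N0); lra.
- by rewrite -(ler_pM2l N0); lra.
- by rewrite (le_trans (ler_norm _)) // (le_trans (cre_nrm _)) // ltW.
Unshelve. all: by end_near. Qed.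

(** The symmetry $y\mapsto-y$ of [h], which reduces the limit ratio $w_0=-1$ to 1. *)
Lemma is_orbitN (a : R) x y (e : C R) : e ^+ 2 = 1 -> is_orbit a x y ->
  is_orbit a x (fun n => e * y n).
Proof.
move=> e2 orb n; have [-> ->] := orb n; split; first by rewrite exprMn e2 mul1r.
by rewrite mulrBr mulrCA.
Qed.

(** By [cone_step] the cone condition persists and the distance between the values of $x-y$ never
    shrinks; as it tends to 0, it is 0 from the start. *)
Lemma cone_expansion (a d : R) x y x' y' : 0 < a -> 0 < d ->
  12 * (1 + a) * d <= 1 / 4 -> is_orbit a x y -> is_orbit a x' y' ->
  (forall n, sector d (x n) (y n)) -> (forall n, sector d (x' n) (y' n)) ->
  x @ \oo --> (0 : C R) -> y @ \oo --> (0 : C R) ->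
  x' @ \oo --> (0 : C R) -> y' @ \oo --> (0 : C R) ->
  nrm ((x 0%N + y 0%N) - (x' 0%N + y' 0%N)) <=
  nrm ((x 0%N - y 0%N) - (x' 0%N - y' 0%N)) ->
  x 0%N - y 0%N = x' 0%N - y' 0%N.
Proof.
move=> a0 d0 da orb orb' S S' x0 y0 x0' y0' c0.
pose p n := nrm ((x n + y n) - (x' n + y' n)).
pose e n := nrm ((x n - y n) - (x' n - y' n)).
have step n : p n <= e n -> p n.+1 <= e n.+1 /\ e n <= e n.+1.
  move=> pe; rewrite /p /e; have [-> ->] := orb n; have [-> ->] := orb' n.
  exact: (cone_step a0 d0 da (S n) (S' n)).
have mono n : p n <= e n /\ e 0%N <= e n.
  elim: n => [|n [pe en]]; first by [].
  by have [? /(le_trans en)] := step _ pe.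
apply/eqP; rewrite -subr_eq0 -[_ == _]negbK -nrm_gt0 -/(e 0%N); apply/negP => e0.
have lim : ((x n - y n) - (x' n - y' n)) @[n --> \oo] --> (0 : C R).
  apply: (cvg_seq_eq (fun=> erefl) (_ : _ = (0 - 0) - (0 - 0))); first by ring.
  by cvg_alg.
have [N _ HN] := cvg_near_nrm e0 lim.
have : e N < e 0%N by have := HN N (leqnn N); rewrite subr0.
have [_ eN] := mono N.
by move/(le_lt_trans eN); rewrite ltxx.
Qed.

End Transversal.

(** * Convergence in the projective line *)

Section Projective.
Variable R : realType.

Lemma continuous_fst : continuous (fst : C2 R -> C R).
Proof. by move=> p; exact: cvg_fst. Qed.

Lemma continuous_snd : continuous (snd : C2 R -> C R).
Proof. by move=> p; exact: cvg_snd. Qed.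

(** The two coordinates, in either order, serve as [f] and [g], so the ratio is an affine chart. The
    set [B e] is open and invariant under scaling, hence the full preimage of its image [S], which
    is therefore open in the quotient. *)
Lemma P1_ratio_cvg (f g : C2 R -> C R) (p : C2nz R) (u : nat -> C2nz R) :
  continuous f -> continuous g ->
  (forall c q, f (c *: q) = c * f q) -> (forall c q, g (c *: q) = c * g q) ->
  g (\val p) != 0 -> P1_class (u n) @[n --> \oo] --> P1_class p ->
  (\forall n \near \oo, g (\val (u n)) != 0) /\
  (f (\val (u n)) / g (\val (u n))) @[n --> \oo] --> f (\val p) / g (\val p).
Proof.
move=> cf cg hf hg gp up.
pose B e : set (C2 R) :=
  [set q | g q != 0 /\ nrm (f q / g q - f (\val p) / g (\val p)) < e].
have oB e : 0 < e -> open (B e).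
  move=> e0; rewrite openE => q [gq fq]; rewrite /interior.
  have gN0 : \forall t \near q, g t != 0.
    have gn : 0 < nrm (g q) by rewrite nrm_gt0.
    apply: filterS (cvg_near_nrm gn (cg q)) => t.
    by apply: contraTneq => ->; rewrite sub0r nrmN ltxx.
  have rc : (f t / g t) @[t --> q] --> f q / g q.
    by apply: cvgM; [exact: cf|apply: cvgV => //; exact: cg].
  set w := f (\val p) / _ in fq *.
  have ep0 : 0 < e - nrm (f q / g q - w) by rewrite subr_gt0.
  have near2 := @cvg_near_nrm _ _ _ (nbhs_filter q) _ _ _ ep0 rc.
  apply: (@filterS _ _ (nbhs_filter q) _ _ _ (filterI gN0 near2)) => t [gt ft].
  split=> //.
  have -> : f t / g t - w = (f t / g t - f q / g q) + (f q / g q - w) by ring.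
  by rewrite (le_lt_trans (nrmD _ _)) // -ltrBrDr.
have key e : 0 < e -> \forall n \near \oo, B e (\val (u n)).
  move=> e0.
  pose S : set (P1 R) := [set c | exists2 q : C2nz R, B e (\val q) & c = P1_class q].
  have pS : (@P1_class R) @^-1` S = [set q | B e (\val q)].
    apply/seteqP; split => [q [r Br]|q Bq]; last by exists q.
    rewrite /P1_class => /eqmodP /asboolP[c [c0 ce]].
    case: Br => gr fr; rewrite /B /=.
    have gE := hg c (\val q); have fE := hf c (\val q); rewrite -ce in gE fE.
    split; first by apply: contraNneq gr => gq; rewrite gE gq mulr0.
    by move: fr; rewrite fE gE -mulf_div divff // mul1r.
  have oS : open S.
    rewrite /open /= /quotient_open.
    rewrite [X in open X](_ : _ = [set q : C2nz R | B e (\val q)]); last exact: pS.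
    by exists (B e); first exact: oB.
  have nS : nbhs (P1_class p) S.
    apply: open_nbhs_nbhs; split => //; exists p => //; split => //.
    by rewrite subrr nrm0.
  have upS : \forall n \near \oo, S (P1_class (u n)) := up _ nS.
  apply: filterS upS => n Sn.
  have : ((@P1_class R) @^-1` S) (u n) by [].
  by rewrite pS.
split; first by apply: filterS (key 1 ltr01) => n [].
by apply: near_nrm_cvg => e e0; apply: filterS (key e e0) => n [].
Qed.

End Projective.

(** * Iterates of h and generic points *)

Section Orbits.
Variable R : realType.
Variable a : R.
Implicit Types (z w : C2 R).

Lemma hE z : h a z = (z.1 - z.2 ^+ 2 + embed a * z.1 ^+ 3, z.2 - z.1 * z.2).
Proof. by case: z. Qed.

Lemma is_orbit_iter z N :
  is_orbit a (fun n => (iter (n + N) (h a) z).1) (fun n => (iter (n + N) (h a) z).2).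
Proof. by move=> n; rewrite addSn iterS hE. Qed.

(** The determinant of the differential of [h] at [z]. *)
Definition jac z : C R :=
  (1 + 3 * embed a * z.1 ^+ 2) * (1 - z.1) - 2 * z.2 ^+ 2.

Definition inv_nat (m : nat) : C R := m.+1%:R^-1.

Lemma inv_nat_neq0 m : inv_nat m != 0.
Proof. by rewrite invr_eq0 pnatr_eq0. Qed.

Lemma cvg_inv_nat : inv_nat @ \oo --> (0 : C R).
Proof.
apply: near_nrm_cvg => e e0.
have [N _ HN] : \forall n \near \oo, e^-1 < n%:R by exact: nbhs_infty_gtr.
exists N => // n Nn; rewrite /inv_nat subr0 nrmV nrm_nat.
by rewrite invf_plt ?posrE // (lt_le_trans (HN n Nn)) // ler_nat.
Qed.

(** The chain rule along a sequence: the limits are the components of the differential of [h] at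
    $(q_1,q_2)$ applied to $(d_1,d_2)$. *)
Lemma cvg_h_quotient (q1 q2 d1 d2 : C R) (p : nat -> C2 R) (s r1 r2 : nat -> C R) :
  (forall m, s m != 0) -> s @ \oo --> (0 : C R) ->
  (forall m, (p m).1 = q1 + s m * r1 m) -> (forall m, (p m).2 = q2 + s m * r2 m) ->
  r1 @ \oo --> d1 -> r2 @ \oo --> d2 ->
  (((h a (p m)).1 - (h a (q1, q2)).1) / s m) @[m --> \oo] -->
    (1 + 3 * embed a * q1 ^+ 2) * d1 - 2 * q2 * d2 /\
  (((h a (p m)).2 - (h a (q1, q2)).2) / s m) @[m --> \oo] -->
    (1 - q1) * d2 - q2 * d1.
Proof.
move=> sN0 s0 p1 p2 c1 c2; set A := embed a.
split.
- apply: (@cvg_seq_eq _ _ (fun m => r1 m - (2 * q2 * r2 m + s m * r2 m ^+ 2)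
      + A * (3 * q1 ^+ 2 * r1 m + 3 * q1 * s m * r1 m ^+ 2
             + s m ^+ 2 * r1 m ^+ 3)) _
    (d1 - (2 * q2 * d2 + 0 * d2 ^+ 2)
      + A * (3 * q1 ^+ 2 * d1 + 3 * q1 * 0 * d1 ^+ 2 + 0 ^+ 2 * d1 ^+ 3))).
  + move=> m; rewrite hE p1 p2 /= -/A.
    by move: (sN0 m); move: (s m) (r1 m) (r2 m) => *; field.
  + by ring.
  + by cvg_alg.
- apply: (@cvg_seq_eq _ _ (fun m => r2 m - (q1 * r2 m + q2 * r1 m
      + s m * r1 m * r2 m)) _ (d2 - (q1 * d2 + q2 * d1 + 0 * d1 * d2))).
  + move=> m; rewrite hE p1 p2 /=.
    by move: (sN0 m); move: (s m) (r1 m) (r2 m) => *; field.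
  + by ring.
  + by cvg_alg.
Qed.

(** The differential of $h^n$ at [z] is a product of invertible maps, hence onto. It enters only
    through difference quotients with step $1/(m+1)$. *)
Lemma iter_h_line_surj z n : (forall j, (j < n)%N -> jac (iter j (h a) z) != 0) ->
  forall D : C2 R, exists w : C2 R,
    let p m := iter n (h a) (z.1 + inv_nat m * w.1, z.2 + inv_nat m * w.2) in
    (((p m).1 - (iter n (h a) z).1) / inv_nat m) @[m --> \oo] --> D.1 /\
    (((p m).2 - (iter n (h a) z).2) / inv_nat m) @[m --> \oo] --> D.2.
Proof.
elim: n => [|n IH] J D.
  exists D; split; apply: (cvg_seq_near _ (cvg_cst _)); apply: nearW => m /=.
    by rewrite addrAC subrr add0r mulrC mulKf // inv_nat_neq0.
  by rewrite addrAC subrr add0r mulrC mulKf // inv_nat_neq0.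
set q := iter n (h a) z.
have Jq : jac q != 0 by exact: J.
(* Cramer's rule: $(D_1,D_2)$ is the preimage of [D] under the differential of [h] at [q]. *)
pose D1 := ((1 - q.1) * D.1 + 2 * q.2 * D.2) / jac q.
pose D2 := (q.2 * D.1 + (1 + 3 * embed a * q.1 ^+ 2) * D.2) / jac q.
have [|w /=] := IH _ (D1, D2); first by move=> j jn; apply: J; rewrite ltnS ltnW.
rewrite -/q => -[c1 c2]; exists w => /=.
pose p m := iter n (h a) (z.1 + inv_nat m * w.1, z.2 + inv_nat m * w.2).
have p1 m : (p m).1 = q.1 + inv_nat m * (((p m).1 - q.1) / inv_nat m).
  by rewrite mulrC divfK ?inv_nat_neq0 // subrKC.
have p2 m : (p m).2 = q.2 + inv_nat m * (((p m).2 - q.2) / inv_nat m).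
  by rewrite mulrC divfK ?inv_nat_neq0 // subrKC.
have [] := cvg_h_quotient inv_nat_neq0 cvg_inv_nat p1 p2 c1 c2.
rewrite -surjective_pairing => l1 l2.
have e1 : D.1 = (1 + 3 * embed a * q.1 ^+ 2) * D1 - 2 * q.2 * D2.
  rewrite /D1 /D2; move: Jq; rewrite /jac; move: (q.1) (q.2) (D.1) (D.2) => *.
  by field.
have e2 : D.2 = (1 - q.1) * D2 - q.2 * D1.
  rewrite /D1 /D2; move: Jq; rewrite /jac; move: (q.1) (q.2) (D.1) (D.2) => *.
  by field.
by rewrite e1 e2; split; [exact: l1|exact: l2].
Qed.

Lemma continuous_h : continuous (h a).
Proof.
move=> p; rewrite (_ : h a = fun z : C2 R =>
  (z.1 - z.2 ^+ 2 + embed a * z.1 ^+ 3, z.2 - z.1 * z.2)); last exact/funext/hE.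
have c1 : (z.1 : C R) @[z --> p] --> p.1 := @continuous_fst R p.
have c2 : (z.2 : C R) @[z --> p] --> p.2 := @continuous_snd R p.
have FF : Filter (nbhs p) := nbhs_filter p.
have lim1 : (z.1 - z.2 ^+ 2 + embed a * z.1 ^+ 3 : C R) @[z --> p] -->
    p.1 - p.2 ^+ 2 + embed a * p.1 ^+ 3.
  exact: (cvgD (cvgB c1 (cvgX (n := 2) c2))
    (cvgM (cvg_cst (embed a)) (cvgX (n := 3) c1))).
have lim2 : (z.2 - z.1 * z.2 : C R) @[z --> p] --> p.2 - p.1 * p.2.
  exact: (cvgB c2 (cvgM c1 c2)).
exact: (cvg_pair lim1 lim2).
Qed.

Lemma continuous_iter_h n : continuous (iter n (h a)).
Proof.
elim: n => [|n IH] p; first exact: cvg_id.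
by apply: continuous_comp; [exact: IH|exact: continuous_h].
Qed.

Lemma cvg_pair0 (p : nat -> C2 R) : p @ \oo --> (0 : C2 R) ->
  ((p n).1 @[n --> \oo] --> (0 : C R)) * ((p n).2 @[n --> \oo] --> (0 : C R)).
Proof.
move=> p0; split.
  exact: (cvg_comp p (fst : C2 R -> C R) p0 (@continuous_fst R 0)).
exact: (cvg_comp p (snd : C2 R -> C R) p0 (@continuous_snd R 0)).
Qed.

Lemma continuous_line (w v : C2 R) :
  {for (0 : R), continuous (fun t : R =>
     (w.1 + embed t * v.1, w.2 + embed t * v.2) : C2 R)}.
Proof.
have ce : embed t @[t --> (0 : R)] --> embed (0 : R) := @continuous_embed R 0.
have lim (x y : C R) : (x + embed t * y) @[t --> (0 : R)] --> x + embed 0 * y.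
  exact: (cvgD (cvg_cst x) (cvgM ce (cvg_cst y))).
exact: (cvg_pair (lim _ _) (lim _ _)).
Qed.

End Orbits.

(** * Points whose orbits avoid the exceptional curves *)

Section Generic.
Variable R : realType.
Variable a : R.

Lemma open_line (U : set (C2 R)) (w v : C2 R) : open U -> U w ->
  exists2 e : R, 0 < e & forall t : R, `|t| < e ->
    U (w.1 + embed t * v.1, w.2 + embed t * v.2).
Proof.
move=> oU Uw.
have nU : nbhs (w.1 + embed (0 : R) * v.1, w.2 + embed (0 : R) * v.2) U.
  rewrite /embed rmorph0 !mul0r !addr0 -surjective_pairing.
  exact: open_nbhs_nbhs.
have /nbhs_ballP[e /= e0 He] := @continuous_line R w v _ nU.
by exists e => // t te; apply: He; rewrite /ball /= sub0r normrN.
Qed.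

Lemma countable_roots (Q : {poly C R}) : Q != 0 ->
  countable [set t : R | root Q (1 + embed t)].
Proof.
move=> Q0; have [r Qr] := closed_field_poly_normal Q.
apply: finite_set_countable.
apply: (@sub_finite_set _ _ [set` [seq cre (z - 1) | z <- r]]).
  move=> t /=; rewrite Qr rootZ ?lead_coef_eq0 // root_prod_XsubC => tr.
  by apply/mapP; exists (1 + embed t) => //; rewrite addrAC subrr add0r.
exact: finite_seq.
Qed.

(** The excluded parameters are countable, hence Lebesgue-null, while $]-e,e[$ has measure
    $2e>0$. *)
Lemma exists_nonroot (Q : nat -> {poly C R}) (e : R) : 0 < e ->
  (forall n, Q n != 0) ->
  exists2 t : R, `|t| < e & forall n, ~~ root (Q n) (1 + embed t).
Proof.
move=> e0 QN0; apply: contrapT => H.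
pose B : set R := \bigcup_(n in setT) [set t : R | root (Q n) (1 + embed t)].
have cB : countable B by apply: bigcup_countable => // n _; exact: countable_roots.
have sub : `]-e, e[%classic `<=` B.
  move=> t; rewrite /= in_itv /= -ltr_norml => te; apply: contrapT => nB.
  apply: H; exists t => // n; apply/negP => rt; apply: nB; by exists n.
have := countable_lebesgue_measure0 (sub_countable (subset_card_le sub) cB).
rewrite lebesgue_measure_itv /= lte_fin gtrN //.
by rewrite -EFinD => -[]; rewrite opprK => /eqP; rewrite gt_eqF // addr_gt0.
Qed.

(* On a line through 0, the conditions on the n-th iterate say that a polynomial
   whose value at 0 is 1 does not vanish. *)
Lemma generic_point (U : set (C2 R)) : open U -> U !=set0 ->
  exists2 z : C2 R, U z & z.2 != 0 /\ forall n,
    1 - (iter n (h a) z).1 != 0 /\ jac a (iter n (h a) z) != 0.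
Proof.
move=> oU [w0 Uw0].
have [w Uw w2] : exists2 w : C2 R, U w & w.2 != 0.
  have [w02|w02] := eqVneq w0.2 0; last by exists w0.
  have [e e0 He] := open_line (0, 1) oU Uw0.
  exists (w0.1 + embed (e / 2) * 0, w0.2 + embed (e / 2) * 1).
    by apply: He; rewrite gtr0_norm ?divr_gt0 // ltr_pdivrMr // ltr_pMr // ltr1n.
  by rewrite /= w02 add0r mulr1 gt_eqF // embed_gt0 divr_gt0.
(* The map [h] acting on pairs of polynomials in the parameter of the line. *)
pose hpoly (p : {poly C R} * {poly C R}) :=
  (p.1 - p.2 ^+ 2 + (embed a)%:P * p.1 ^+ 3, p.2 - p.1 * p.2).
pose P n := iter n hpoly (w.1%:P * 'X, w.2%:P * 'X).
have PE n t : iter n (h a) (w.1 * t, w.2 * t) = ((P n).1.[t], (P n).2.[t]).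
  elim: n => [|n IH]; first by rewrite /P /= !hornerE.
  by rewrite iterS IH hE /P iterS -/(P n) /= !hornerE.
pose Q n := (1 - (P n).1) *
  ((1 + 3%:P * (embed a)%:P * (P n).1 ^+ 2) * (1 - (P n).1) - 2%:P * (P n).2 ^+ 2).
have QE n t : (Q n).[t] = (1 - (iter n (h a) (w.1 * t, w.2 * t)).1)
    * jac a (iter n (h a) (w.1 * t, w.2 * t)).
  by rewrite PE /jac /Q /= !hornerE.
have h0 n : iter n (h a) (0, 0) = (0, 0).
  elim: n => // n IH; rewrite iterS IH hE /=.
  by rewrite !expr0n /= !mulr0 !subr0 addr0.
have QN0 n : Q n != 0.
  have : (Q n).[0] != 0.
    rewrite QE !mulr0 h0 /jac /=; rewrite !expr0n /= !mulr0 !subr0 addr0 !mul1r.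
    exact: oner_neq0.
  by apply: contraNneq => ->; rewrite horner0.
have [e e0 He] := open_line w oU Uw.
have e1 : 0 < Num.min e 1 by rewrite lt_min e0 ltr01.
(* The parameter 1 gives [w]. At $1+t$ the point remains in [U] since $|t|<e$, and its second
   coordinate remains nonzero since $|t|<1$. *)
have [t] := exists_nonroot e1 QN0; rewrite lt_min => /andP[te t1] Ht.
have tN0 : 1 + embed t != 0.
  apply: contraTneq t1 => /(congr1 (@cre R)); rewrite creD.
  have -> : cre (embed t) = t by [].
  have -> : cre 1 = 1 :> R by [].
  have -> : cre 0 = 0 :> R by [].
  by move=> /eqP; rewrite addrC addr_eq0 => /eqP ->; rewrite normrN normr1 ltxx.
have zE : (w.1 + embed t * w.1, w.2 + embed t * w.2)
    = (w.1 * (1 + embed t), w.2 * (1 + embed t)) by congr pair; ring.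
exists (w.1 + embed t * w.1, w.2 + embed t * w.2); first exact: He.
rewrite zE; split => [/=|n]; first by rewrite mulf_neq0.
have := Ht n; rewrite /root QE mulf_eq0 negb_or.
by move/andP.
Qed.

End Generic.

(** * Baire's theorem in C2 and conclusion *)

HB.instance Definition _ (R : realType) := Complete.on 'rV[R]_4.

Section BaireC2.
Variable R : realType.

(** The homeomorphism from $\mathbb{R}^4$ through which Baire's theorem, applied in a complete real
    space, is carried to $\mathbb{C}^2$. *)
Definition of_rV4 (m : 'rV[R]_4) : C2 R :=
  (embed (m 0 0) + 'i%C * embed (m 0 1), embed (m 0 2%:R) + 'i%C * embed (m 0 3%:R)).

Definition to_rV4 (z : C2 R) : 'rV[R]_4 :=
  \row_i nth 0 [:: cre z.1; cim z.1; cre z.2; cim z.2] i.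

Lemma to_rV4K : cancel to_rV4 of_rV4.
Proof. by case=> x y; rewrite /of_rV4 !mxE /= -!cre_cim. Qed.

Lemma of_rV4K : cancel of_rV4 to_rV4.
Proof.
move=> m; apply/rowP => i; rewrite mxE.
have re (x y : R) : cre (embed x + 'i%C * embed y) = x.
  by rewrite /cre /= !mul0r mul1r subr0 addr0.
have im (x y : R) : cim (embed x + 'i%C * embed y) = y.
  by rewrite /cim /= !mul0r mul1r !add0r.
have -> : cre (of_rV4 m).1 = m 0 0 := re _ _.
have -> : cim (of_rV4 m).1 = m 0 1 := im _ _.
have -> : cre (of_rV4 m).2 = m 0 2%:R := re _ _.
have -> : cim (of_rV4 m).2 = m 0 3%:R := im _ _.
case: i => [] [|[|[|[|//]]]] i4 /=; congr (m _ _); exact: val_inj.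
Qed.

Lemma continuous_of_rV4 : continuous of_rV4.
Proof.
move=> m; have FF : Filter (nbhs m) := nbhs_filter m.
have c i : embed (n 0 i) @[n --> m] --> embed (m 0 i).
  exact: (cvg_comp _ _ (@coord_continuous _ _ _ 0 i m) (@continuous_embed R _)).
have l i j : (embed (n 0 i) + 'i%C * embed (n 0 j) : C R) @[n --> m]
    --> embed (m 0 i) + 'i%C * embed (m 0 j).
  exact: (cvgD (c i) (cvgM (cvg_cst ('i%C : C R)) (c j))).
exact: (cvg_pair (l _ _) (l _ _)).
Qed.

Lemma continuous_cre : continuous (@cre R).
Proof.
move=> x; have FF : Filter (nbhs x) := nbhs_filter x.
apply/cvgrPdist_lt => e e0.
have H := @cvg_near_nrm _ _ (nbhs x) (nbhs_filter x) id x e e0 (@cvg_id _ _).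
apply: (@filterS _ _ (nbhs_filter x) _ _ _ H) => t.
by rewrite distrC -creB; apply: le_lt_trans; exact: cre_nrm.
Qed.

Lemma continuous_cim : continuous (@cim R).
Proof.
move=> x; have FF : Filter (nbhs x) := nbhs_filter x.
apply/cvgrPdist_lt => e e0.
have H := @cvg_near_nrm _ _ (nbhs x) (nbhs_filter x) id x e e0 (@cvg_id _ _).
apply: (@filterS _ _ (nbhs_filter x) _ _ _ H) => t; rewrite distrC; apply: le_lt_trans.
have cB (p q : C R) : cim p - cim q = cim (p - q) by case: p q => [? ?] [? ?].
rewrite cB.
exact: cim_nrm.
Qed.

Lemma continuous_nrm : continuous (@nrm R).
Proof.
move=> x; have FF : Filter (nbhs x) := nbhs_filter x.
apply/cvgrPdist_lt => e e0.
have H := @cvg_near_nrm _ _ (nbhs x) (nbhs_filter x) id x e e0 (@cvg_id _ _).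
apply: (@filterS _ _ (nbhs_filter x) _ _ _ H) => t; rewrite distrC; apply: le_lt_trans.
have h1 := nrmD (t - x) x; have h2 := nrmB t (t - x).
rewrite subrK in h1; rewrite subKr in h2.
by rewrite ler_norml; lra.
Qed.

Lemma continuous_to_rV4 : continuous to_rV4.
Proof.
move=> z; apply/cvg_ballP => e e0.
have FF : Filter (nbhs z) := nbhs_filter z.
have c1 := cvg_comp _ _ (@continuous_fst R z).
have c2 := cvg_comp _ _ (@continuous_snd R z).
have l1 : cre t.1 @[t --> z] --> cre z.1 := c1 _ _ _ (@continuous_cre z.1).
have l2 : cim t.1 @[t --> z] --> cim z.1 := c1 _ _ _ (@continuous_cim z.1).
have l3 : cre t.2 @[t --> z] --> cre z.2 := c2 _ _ _ (@continuous_cre z.2).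
have l4 : cim t.2 @[t --> z] --> cim z.2 := c2 _ _ _ (@continuous_cim z.2).
near=> t; split=> // i j.
rewrite !mxE.
case: j => [] [|[|[|[|//]]]] i4 /=; near: t.
- exact: (cvg_ball l1).
- exact: (cvg_ball l2).
- exact: (cvg_ball l3).
- exact: (cvg_ball l4).
Unshelve. all: by end_near. Qed.

(** If no [A n] contained a non-empty open part of [U], the sets [F n] would be open and dense, and
    Baire would give a point of [U] outside every [A n]. *)
Lemma baire_C2 (U : set (C2 R)) (A : nat -> set (C2 R)) :
  open U -> U !=set0 -> (forall n, closed (A n)) -> U `<=` \bigcup_n A n ->
  exists n, exists V : set (C2 R), [/\ open V, V !=set0, V `<=` U & V `<=` A n].
Proof.
move=> oU [u0 Uu0] cA cover; apply: contrapT => H.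
pose O := of_rV4 @^-1` U.
have oO : open O by apply: open_comp => // m _; exact: continuous_of_rV4.
(* The second set ensures density away from [O], where nothing is known of [A n]. *)
pose F n := (of_rV4 @^-1` (~` A n)) `|` ~` closure O.
have F_open_dense n : open (F n) /\ dense (F n).
  split.
    apply: openU; last by rewrite openC; exact: closed_closure.
    by apply: open_comp; [move=> m _; exact: continuous_of_rV4|rewrite openC].
  move=> V [v Vv] oV; have [VO|VO] := pselect (V `&` O !=set0); last first.
    exists v; split=> //; right => /(_ V (open_nbhs_nbhs (conj oV Vv))) [t [Ot Vt]].
    by apply: VO; exists t.
  apply: contrapT => VF; apply: H; exists n.
  exists (to_rV4 @^-1` (V `&` O)); split.
  - by apply: open_comp; [move=> m _; exact: continuous_to_rV4|exact: openI].
  - by case: VO => m VOm; exists (of_rV4 m); rewrite /preimage /= of_rV4K.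
  - by move=> z [_]; rewrite /O /preimage /= to_rV4K.
  - move=> z [Vz _]; apply: contrapT => Az; apply: VF.
    by exists (to_rV4 z); split => //; left; rewrite /preimage /= to_rV4K.
have [|m [Om Fm]] := Baire F_open_dense _ oO.
  by exists (to_rV4 u0); rewrite /O /preimage /= to_rV4K.
have [n _ An] := cover _ Om.
by have [] := Fm n I => //; apply; exact: subset_closure.
Qed.

Lemma closed_le_fun (f g : C2 R -> R) : continuous f -> continuous g ->
  closed [set z | f z <= g z].
Proof.
move=> cf cg; rewrite (_ : mkset _ = (fun z => f z - g z) @^-1` [set x | x <= 0]).
  apply: closed_comp; last exact: closed_le.
  by move=> z _; apply: (cvgB (cf z) (cg z)).
by apply/seteqP; split => z /=; rewrite subr_le0.
Qed.

End BaireC2.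

(** * Exclusion of open sets of attracted points, and conclusion *)

Section Final.
Variable R : realType.
Variable a : R.

Let xs z n : C R := (iter n (h a) z).1.
Let ys z n : C R := (iter n (h a) z).2.

(** At a generic point $y_{n+1}=(1-x_n)y_n$ never vanishes, so [no_orbit_along_x] applies to its
    orbit. *)
Lemma no_open_set_along_x (U : set (C2 R)) : 0 < a -> open U -> U !=set0 ->
  (forall z, U z -> iter n (h a) z @[n --> \oo] --> (0 : C2 R) /\
     (\forall n \near \oo, xs z n != 0) /\
     (ys z n / xs z n) @[n --> \oo] --> (0 : C R)) -> False.
Proof.
move=> a0 oU neU conv.
have [z Uz [z2 gen]] := generic_point a oU neU.
have [z0 [[N _ xN] uz]] := conv z Uz.
have [x0 _] := cvg_pair0 z0.
have yN0 n : ys z n != 0.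
  elim: n => [//|n IH]; rewrite /ys iterS hE /=.
  have [g _] := gen n.
  have -> : forall x y : C R, y - x * y = (1 - x) * y by move=> x y; ring.
  by rewrite mulf_neq0.
apply: (no_orbit_along_x a0 (is_orbit_iter a z N)).
- by move=> n; apply: xN; exact: leq_addl.
- by move=> n; exact: yN0.
- exact: shift_cvgn x0.
- exact: shift_cvgn uz.
Qed.

Lemma closed_sector (d : R) (e : C R) : closed [set z : C2 R | sector d z.1 (e * z.2)].
Proof.
have c1 := @continuous_fst R; have c2 := @continuous_snd R.
have ccre z : cre t.1 @[t --> z] --> cre (z : C2 R).1.
  exact: (cvg_comp _ _ (c1 z) (@continuous_cre R z.1)).
have ccim z : cim t.1 @[t --> z] --> cim (z : C2 R).1.
  exact: (cvg_comp _ _ (c1 z) (@continuous_cim R z.1)).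
have cdre : continuous (fun z : C2 R => d * cre z.1).
  by move=> z; have FF : Filter (nbhs z) := nbhs_filter z;
    exact: (cvgM (cvg_cst d) (ccre z)).
rewrite (_ : mkset _ = [set z : C2 R | nrm (z.1 - e * z.2) <= d * cre z.1] `&`
  ([set z : C2 R | `|cim z.1| <= d * cre z.1] `&` [set z : C2 R | cre z.1 <= d])).
  apply: closedI; first apply: closed_le_fun => //.
    move=> z; have FF : Filter (nbhs z) := nbhs_filter z.
    have l : (t.1 - e * t.2 : C R) @[t --> z] --> z.1 - e * z.2.
      exact: (cvgB (c1 z) (cvgM (cvg_cst e) (c2 z))).
    exact: (cvg_comp _ _ l (@continuous_nrm R _)).
  apply: closedI; apply: closed_le_fun => //.
  - move=> z; have FF : Filter (nbhs z) := nbhs_filter z.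
    exact: (cvg_norm (ccim z)).
  - by move=> z; exact: cvg_cst.
by apply/seteqP; split => z /=; [case=> ? ? ?; split|case=> ? [? ?]; split].
Qed.

Lemma no_open_set_transversal (U : set (C2 R)) (w0 : C R) : 0 < a -> open U -> U !=set0 ->
  (forall z, U z -> iter n (h a) z @[n --> \oo] --> (0 : C2 R) /\
     (\forall n \near \oo, ys z n != 0) /\
     (xs z n / ys z n) @[n --> \oo] --> w0) -> False.
Proof.
move=> a0 oU neU conv.
have w2 : w0 ^+ 2 = 1.
  have [z Uz] := neU; have [z0 [[N _ yN] uz]] := conv z Uz.
  have [x0 _] := cvg_pair0 z0.
  have [] := transversal_limit (is_orbit_iter a z N) _ (shift_cvgn N x0)
    (shift_cvgn N uz) => //.
  by move=> n; apply: yN; exact: leq_addl.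
have wN0 : w0 != 0 by rewrite -sqrf_eq0 w2 oner_neq0.
(* The largest value that [cone_step] allows. *)
pose d : R := (48 * (1 + a))^-1.
have K0 : 0 < 1 + a by rewrite addr_gt0.
have d0 : 0 < d by rewrite invr_gt0 mulr_gt0.
have dK : 12 * (1 + a) * d <= 1 / 4.
  by rewrite le_eqVlt; apply/orP; left; apply/eqP; rewrite /d; field; rewrite gt_eqF.
pose S : set (C2 R) := [set z | sector d z.1 (w0 * z.2)].
(* The points whose orbits stay in the sector from time [N] on: closed sets covering [U], one of
   which contains a non-empty open [V] by Baire. *)
pose A N : set (C2 R) := \bigcap_(n in [set n | (N <= n)%N]) (iter n (h a) @^-1` S).
have cA N : closed (A N).
  apply: closed_bigI => n _; apply: closed_comp; last exact: closed_sector.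
  by move=> z _; exact: continuous_iter_h.
have cover : U `<=` \bigcup_n A n.
  move=> z Uz; have [z0 [[N _ yN] uz]] := conv z Uz.
  have [x0 _] := cvg_pair0 z0.
  have yN' n : w0 * ys z (n + N) != 0 by rewrite mulf_neq0 // yN //= leq_addl.
  have u1 : (xs z (n + N) / (w0 * ys z (n + N))) @[n --> \oo] --> (1 : C R).
    apply: (@cvg_seq_eq _ _
      (fun n => xs z (n + N) / ys z (n + N) * w0^-1) _ (w0 * w0^-1)).
    - by move=> n; rewrite invfM mulrA mulrAC.
    - by rewrite divff.
    - exact: (cvgM (shift_cvgn N uz) (cvg_cst w0^-1)).
  have [M _ HM] := eventually_sector d0 (is_orbitN w2 (is_orbit_iter a z N)) yN'
    (shift_cvgn N x0) u1.
  exists (M + N)%N => // n /= Mn; rewrite /S /=.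
  have Nn : (N <= n)%N by rewrite (leq_trans _ Mn) // leq_addl.
  by rewrite -(subnK Nn); apply: HM; rewrite /= leq_subRL // addnC.
have [N [V [oV neV VU VA]]] := baire_C2 oU neU cA cover.
have [z Vz [_ gen]] := generic_point a oV neV.
(* After $y\mapsto w_0y$ the direction $(1,-w_0)$ becomes $(1,-1)$: at time [N], to first order,
   $x+w_0y$ is stationary while $x-w_0y$ moves at rate 2. So the nearby orbits start inside the
   cone. *)
have [w] := @iter_h_line_surj R a z N (fun j _ => (gen j).2) (1, - w0).
set zz := fun m : nat => (z.1 + inv_nat R m * w.1, z.2 + inv_nat R m * w.2) : C2 R.
move=> /= [c1 c2].
have zzV : \forall m \near \oo, V (zz m).
  have s0 := @cvg_inv_nat R.
  have l (x y : C R) : (x + inv_nat R m * y) @[m --> \oo] --> x.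
    apply: (cvg_seq_eq (fun=> erefl) (_ : _ = x + 0 * y)).
      by rewrite mul0r addr0.
    exact: (cvgD (cvg_cst x) (cvgM s0 (cvg_cst y))).
  have lz : zz m @[m --> \oo] --> z.
    rewrite [z in X in _ --> X]surjective_pairing.
    exact: (cvg_pair (l _ _) (l _ _)).
  exact: (lz _ (open_nbhs_nbhs (conj oV Vz))).
pose r1 m := (xs (zz m) N - xs z N) / inv_nat R m.
pose r2 m := (ys (zz m) N - ys z N) / inv_nat R m.
have r11 : r1 @ \oo --> (1 : C R) := c1.
have r21 : r2 @ \oo --> (- w0 : C R) := c2.
have cp : (r1 m + w0 * r2 m) @[m --> \oo] --> (0 : C R).
  apply: (cvg_seq_eq (fun=> erefl) (_ : _ = 1 + w0 * - w0)).
    by rewrite mulrN -expr2 w2 subrr.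
  exact: (cvgD r11 (cvgM (cvg_cst w0) r21)).
have cm : (r1 m - w0 * r2 m) @[m --> \oo] --> (2 : C R).
  apply: (cvg_seq_eq (fun=> erefl) (_ : _ = 1 - w0 * - w0)).
    by rewrite mulrN -expr2 w2 opprK.
  exact: (cvgB r11 (cvgM (cvg_cst w0) r21)).
have np : \forall m \near \oo, nrm (r1 m + w0 * r2 m - 0) < 1.
  exact: (cvg_near_nrm ltr01 cp).
have nm : \forall m \near \oo, nrm (r1 m - w0 * r2 m - 2) < 1.
  exact: (cvg_near_nrm ltr01 cm).
have [m [Vm pm mm]] : exists m, [/\ V (zz m), nrm (r1 m + w0 * r2 m - 0) < 1
    & nrm (r1 m - w0 * r2 m - 2) < 1].
  have [M _ HM] := filterI zzV (filterI np nm).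
  by have [? [? ?]] := HM M (leqnn M); exists M.
rewrite subr0 in pm.
have m1 : 1 < nrm (r1 m - w0 * r2 m).
  have := nrmB (r1 m - w0 * r2 m) (r1 m - w0 * r2 m - 2).
  by rewrite subKr nrm_nat; lra.
have sN0 := inv_nat_neq0 R m.
have rp : (xs (zz m) N + w0 * ys (zz m) N) - (xs z N + w0 * ys z N)
    = inv_nat R m * (r1 m + w0 * r2 m).
  by rewrite /r1 /r2; move: (xs _ _) (xs _ _) (ys _ _) (ys _ _) => *; field.
have rm : (xs (zz m) N - w0 * ys (zz m) N) - (xs z N - w0 * ys z N)
    = inv_nat R m * (r1 m - w0 * r2 m).
  by rewrite /r1 /r2; move: (xs _ _) (xs _ _) (ys _ _) (ys _ _) => *; field.
have orbit z' : V z' -> [/\ forall n, sector d (xs z' (n + N)) (w0 * ys z' (n + N)),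
    xs z' (n + N) @[n --> \oo] --> (0 : C R) &
    (w0 * ys z' (n + N)) @[n --> \oo] --> (0 : C R)].
  move=> Vz'; have [z0 _] := conv _ (VU _ Vz'); have [x0 y0] := cvg_pair0 z0; split.
  - by move=> n; apply: (VA _ Vz'); exact: leq_addl.
  - exact: shift_cvgn x0.
  - apply: (cvg_seq_eq (fun=> erefl) (_ : _ = w0 * 0)); first by rewrite mulr0.
    exact: (cvgM (cvg_cst w0) (shift_cvgn N y0)).
have o z' : is_orbit a (fun n => xs z' (n + N)) (fun n => w0 * ys z' (n + N)).
  exact: is_orbitN w2 (is_orbit_iter a z' N).
have [S1 x1 y1] := orbit _ Vm; have [S2 x2 y2] := orbit _ Vz.
have ce := cone_expansion a0 d0 dK (o (zz m)) (o z) S1 S2 x1 y1 x2 y2.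
have eq0 : xs (zz m) N - w0 * ys (zz m) N = xs z N - w0 * ys z N.
  rewrite add0n in ce; apply: ce.
  rewrite rp rm !nrmM ler_wpM2l ?nrm_ge0 //; apply: ltW; exact: lt_trans m1.
(* The equality given by [cone_expansion] contradicts a separation of norm greater than that of
   [inv_nat R m]. *)
move: rm; rewrite eq0 subrr => /esym /eqP.
rewrite mulf_eq0 (negbTE sN0) /= => /eqP r0.
by move: m1; rewrite r0 nrm0 ltNge ler01.
Qed.

End Final.

Theorem theorem3 (R : realType) (a : R) (ha : 0 < a) (v : P1 R) :
  ~ exists Omega : set (C2 R), domain_of_attraction (h a) v Omega.
Proof.
move=> [U [[neU oU _] _ _ conv]].
pose p := repr v.
have vE : v = P1_class p by rewrite /P1_class reprK.
have c1 := @continuous_fst R; have c2 := @continuous_snd R.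
have h1 (c : C R) (q : C2 R) : (c *: q).1 = c * q.1 by [].
have h2 (c : C R) (q : C2 R) : (c *: q).2 = c * q.2 by [].
(* The direction is $[1:0]$ in the first case, read in the chart $y/x$; any other direction is read
   in the chart $x/y$. *)
have [p2|p2] := eqVneq (\val p).2 0.
  have p1 : (\val p).1 != 0.
    have : \val p != 0 := set_mem (valP p).
    by apply: contraNneq => p1; rewrite [\val p]surjective_pairing p1 p2.
  apply: (no_open_set_along_x ha oU neU) => z Uz; have [z0 [u [uE uv]]] := conv z Uz.
  rewrite vE in uv.
  have [nz lim] := P1_ratio_cvg c2 c1 h2 h1 p1 uv.
  rewrite p2 mul0r in lim.
  split; [exact: z0|split].
    by apply: filterS nz => n; rewrite uE.
  by apply: (cvg_seq_eq _ erefl lim) => n; rewrite uE.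
apply: (no_open_set_transversal ha oU neU (w0 := (\val p).1 / (\val p).2)) => z Uz.
have [z0 [u [uE uv]]] := conv z Uz.
rewrite vE in uv.
have [nz lim] := P1_ratio_cvg c1 c2 h1 h2 p2 uv.
split; [exact: z0|split].
  by apply: filterS nz => n; rewrite uE.
by apply: (cvg_seq_eq _ erefl lim) => n; rewrite uE.
Qed.
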